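(* Let $M^2$ be a surface isometrically immersed in $\mathbb{R}^4$, and let $F$ be the rank $2$ sub-bundle of $\wedge^2_-(\mathbb{R}^4)|_M$ which is the orthogonal complement of the line bundle $E$ spanned by $\omega^1 = e^1\wedge e^2 - \nu^1\wedge\nu^2$. The total space of $F$ over $M$ is a coassociative submanifold of $\wedge^2_-(\mathbb{R}^4)\cong\mathbb{R}^7$ if and only if the second fundamental form $A^\nu$ of the immersion $M\subset\mathbb{R}^4$ satisfies $$A^{J\nu} = -J A^{\nu}$$ for all normal vector fields $\nu$ (that is, $A^{J\nu}(w) = -J(A^\nu(w))$ for all tangent vectors $w$ to $M$).
   Context: $\mathbb{R}^4$ carries its standard metric and orientation and Levi-Civita connection $\nabla$. For a normal vector field $\nu$ on $M$, $A^\nu : TM\to TM$ is $A^\nu(w) = (\nabla_w\nu)^T$, where $(\cdot)^T$ is orthogonal projection onto $TM$. Let $e_1,e_2$ be a local orthonormal tangent frame and $\nu_1,\nu_2$ a local orthonormal normal frame of $M$ such that $(e_1,e_2,\nu_1,\nu_2)$ is positively oriented in $\mathbb{R}^4$, with dual coframes $e^1,e^2,\nu^1,\nu^2$. Along $M$, $\wedge^2_-(\mathbb{R}^4)|_M$ (anti-self-dual $2$-forms) is spanned by $\omega^1 = e^1\wedge e^2-\nu^1\wedge\nu^2$, $\omega^2 = e^1\wedge\nu^1-\nu^2\wedge e^2$, $\omega^3 = e^1\wedge\nu^2-e^2\wedge\nu^1$. Up to sign $\omega^1$ does not depend on the choice of frames, so $E=\operatorname{span}(\omega^1)$ and $F=\operatorname{span}(\omega^2,\omega^3)$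 are well-defined bundles over $M$. The total space of $F$ is regarded as an immersed $4$-dimensional submanifold of the total space of $\wedge^2_-(\mathbb{R}^4)$. $\mathrm{G}_2$-structure on $\wedge^2_-(\mathbb{R}^4) = \mathbb{R}^4\oplus\mathbb{R}^3\cong\mathbb{R}^7$: for an oriented orthonormal coframe $e^1,\dots,e^4$ of $\mathbb{R}^4$ put $\omega^1=e^1\wedge e^2-e^3\wedge e^4$, $\omega^2=e^1\wedge e^3-e^4\wedge e^2$, $\omega^3=e^1\wedge e^4-e^2\wedge e^3$. The vectors $\bar e_i=(e_i,0)$ and $\check\omega^i=(0,\omega^i)$ are declared to be an orthonormal tangent frame of the total space; let $\bar e^i,\check\omega_i$ be the dual coframe. The $3$-form is $$\varphi=\check\omega_1\wedge\check\omega_2\wedge\check\omega_3+\check\omega_1\wedge(\bar e^1\wedge\bar e^2-\bar e^3\wedge\bar e^4)+\check\omega_2\wedge(\bar e^1\wedge\bar e^3-\bar e^4\wedge\bar e^2)+\check\omega_3\wedge(\bar e^1\wedge\bar e^4-\bar e^2\wedge\bar e^3),$$ which is independent of the choice of oriented orthonormal coframe. A $4$-dimensional submanifold $L$ is coassociative if and only if $\varphi|_L=0$. $J$ denotes the natural almost complex structure on an oriented rank $2$ bundle with fibre metric: $Jv_1=v_2$, $Jv_2=-v_1$ for an oriented orthonormal basis $v_1,v_2$ of a fibre. In $A^{J\nu}=-JA^\nu$, the $J$ on the left is that of the normal bundle $N(M)$ and the $J$ on the right is that of $T(M)$. A (local) choice of orientation of $T(M)$ determines that of $N(M)$ through the orientation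 of $\mathbb{R}^4$; the condition is unchanged if both orientations are reversed. *)

(* Defs.v *)
From mathcomp Require Import all_boot all_order all_algebra.
From mathcomp Require Import all_classical all_reals all_analysis.
Import Order.TTheory GRing.Theory Num.Theory.
Import numFieldNormedType.Exports.

Set Implicit Arguments.
Unset Strict Implicit.
Unset Printing Implicit Defensive.

Local Open Scope classical_set_scope.
Local Open Scope ring_scope.

(* [Ck k U f] is meant for [U] open; differentials are Frechet differentials
   in the ambient space. *)
Fixpoint Ck (R : realType) (V W : normedModType R) (k : nat) (U : set V)
    (f : V -> W) : Prop :=
  match k with
  | 0%N => forall x, U x -> {for x, continuous f}
  | k'.+1 => (forall x, U x -> differentiable f x) /\
             forall v : V, Ck k' U (fun x => 'D_v f x)
  end.

Definition smooth_on (R : realType) (V W : normedModType R) (U : set V)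
    (f : V -> W) : Prop := forall k, Ck k U f.

(* [coord i] is a chart with domain [chart_dom i], and [param i] its inverse;
   the values of these functions outside the respective domains are junk.
   Neither connectedness nor orientability is assumed. *)
Record smoothSurface (R : realType) := SmoothSurface {
  surface_carrier :> topologicalType;
  surface_hausdorff : hausdorff_space surface_carrier;
  surface_second_countable : @second_countable surface_carrier;
  chart_index : Type;
  chart_dom : chart_index -> set surface_carrier;
  coord : chart_index -> surface_carrier -> 'rV[R]_2;
  param : chart_index -> 'rV[R]_2 -> surface_carrier;
  chart_cover : forall p, exists i, chart_dom i p;
  chart_dom_open : forall i, open (chart_dom i);
  coord_open : forall i, open (coord i @` chart_dom i);
  coordK : forall i p, chart_dom i p -> param i (coord i p) = p;
  coord_continuous : forall i p, chart_dom i p -> {for p, continuous (coord i)};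
  param_continuous : forall i u, (coord i @` chart_dom i) u ->
    {for u, continuous (param i)};
  transition_smooth : forall i j,
    smooth_on (coord i @` (chart_dom i `&` chart_dom j)) (coord j \o param i)
}.

(* Smoothness on an open set [V] of the surface. *)
Definition smooth_map (R : realType) (M : smoothSurface R)
    (W : normedModType R) (V : set M) (g : M -> W) : Prop :=
  forall i : chart_index M,
    smooth_on (@coord R M i @` (chart_dom i `&` V)) (g \o @param R M i).

Definition smooth_curve (R : realType) (M : smoothSurface R) (I : set R)
    (c : R -> M) : Prop :=
  (forall t, I t -> {for t, continuous c}) /\
  forall i : chart_index M,
    smooth_on (I `&` c @^-1` chart_dom i) (@coord R M i \o c).

Definition immersion (R : realType) (M : smoothSurface R)
    (f : M -> 'rV[R]_4) : Prop :=
  smooth_map [set: M] f /\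
  forall (i : chart_index M) (p : M), chart_dom i p ->
    injective ('d (f \o @param R M i) (coord i p)).

Definition dot (R : realType) (x y : 'rV[R]_4) : R := (x *m y^T) 0 0.

Definition curve_at (R : realType) (M : smoothSurface R) (p : M)
    (c : R -> M) : Prop :=
  c 0 = p /\ exists I : set R, [/\ open I, I 0 & smooth_curve I c].

(* T_p M, as the plane df(T_p M) of R^4. *)
Definition tangent_at (R : realType) (M : smoothSurface R)
    (f : M -> 'rV[R]_4) (p : M) : set 'rV[R]_4 :=
  [set w | exists c : R -> M, curve_at p c /\ w = derive1 (f \o c) 0].

Definition normal_at (R : realType) (M : smoothSurface R)
    (f : M -> 'rV[R]_4) (p : M) : set 'rV[R]_4 :=
  [set n | forall w, tangent_at f p w -> dot n w = 0].

Definition normal_field (R : realType) (M : smoothSurface R)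
    (f : M -> 'rV[R]_4) (V : set M) (nu : M -> 'rV[R]_4) : Prop :=
  smooth_map V nu /\ forall p, V p -> normal_at f p (nu p).

(* The directional derivative of the R^4-valued field [nu] in the tangent
   direction [w]: the derivative of [nu] along any curve whose image in R^4
   has velocity [w]. *)
Definition nabla (R : realType) (M : smoothSurface R) (f : M -> 'rV[R]_4)
    (nu : M -> 'rV[R]_4) (p : M) (w : 'rV[R]_4) : 'rV[R]_4 :=
  xget 0 [set d | exists c : R -> M,
    [/\ curve_at p c, w = derive1 (f \o c) 0 & d = derive1 (nu \o c) 0]].

Definition tangent_proj (R : realType) (M : smoothSurface R)
    (f : M -> 'rV[R]_4) (p : M) (x : 'rV[R]_4) : 'rV[R]_4 :=
  xget 0 [set y | tangent_at f p y /\ normal_at f p (x - y)].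

Definition shape_op (R : realType) (M : smoothSurface R) (f : M -> 'rV[R]_4)
    (nu : M -> 'rV[R]_4) (p : M) (w : 'rV[R]_4) : 'rV[R]_4 :=
  tangent_proj f p (nabla f nu p w).

(* M carries the metric induced by f. The rows of [b] are e_1, e_2, nu_1, nu_2. *)
Definition adapted_frame (R : realType) (M : smoothSurface R)
    (f : M -> 'rV[R]_4) (p : M) (b : 'M[R]_4) : Prop :=
  [/\ tangent_at f p (row 0 b) /\ tangent_at f p (row 1 b),
      normal_at f p (row 2 b) /\ normal_at f p (row 3 b),
      b *m b^T = 1%:M & 0 < \det b].

Definition local_adapted_frame (R : realType) (M : smoothSurface R)
    (f : M -> 'rV[R]_4) (V : set M) (b : M -> 'M[R]_4) : Prop :=
  smooth_map V b /\ forall p, V p -> adapted_frame f p (b p).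

(* J on the oriented plane with oriented orthonormal basis v1, v2. *)
Definition rotJ (R : realType) (v1 v2 x : 'rV[R]_4) : 'rV[R]_4 :=
  dot x v1 *: v2 - dot x v2 *: v1.

Definition JT (R : realType) (b : 'M[R]_4) (w : 'rV[R]_4) : 'rV[R]_4 :=
  rotJ (row 0 b) (row 1 b) w.

Definition JN (R : realType) (b : 'M[R]_4) (n : 'rV[R]_4) : 'rV[R]_4 :=
  rotJ (row 2 b) (row 3 b) n.

(* A local orientation of T(M), and with it of N(M), is carried by the local
   adapted frame [b] on the open set [V]. *)
Definition second_form_condition (R : realType) (M : smoothSurface R)
    (f : M -> 'rV[R]_4) : Prop :=
  forall (V : set M) (b : M -> 'M[R]_4) (nu : M -> 'rV[R]_4),
    open V -> local_adapted_frame f V b -> normal_field f V nu ->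
    forall (p : M) (w : 'rV[R]_4), V p -> tangent_at f p w ->
      shape_op f (fun q => JN (b q) (nu q)) p w = - JT (b p) (shape_op f nu p w).

(* A 2-form [eta] is encoded by the matrix of its values on the standard
   basis, and covectors are identified with row vectors, so that the dual
   coframe of an orthonormal frame consists of the same row vectors. *)
Definition wedge (R : realType) (a b : 'rV[R]_4) : 'M[R]_4 :=
  a^T *m b - b^T *m a.

Definition std_e (R : realType) (i : 'I_4) : 'rV[R]_4 := row i 1%:M.

(* Hodge star: e^{01} <-> e^{23}, e^{02} <-> e^{31}, e^{03} <-> e^{12}. *)
Definition hodge (R : realType) (eta : 'M[R]_4) : 'M[R]_4 :=
  let e := std_e R in
  eta 2 3 *: wedge (e 0) (e 1) + eta 3 1 *: wedge (e 0) (e 2) +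
  eta 1 2 *: wedge (e 0) (e 3) + eta 0 1 *: wedge (e 2) (e 3) +
  eta 0 2 *: wedge (e 3) (e 1) + eta 0 3 *: wedge (e 1) (e 2).

Definition asd (R : realType) (eta : 'M[R]_4) : Prop :=
  eta^T = - eta /\ hodge eta = - eta.

(* The rows of [b] are e^1, e^2, e^3, e^4, with e^3 = nu^1 and e^4 = nu^2 for
   an adapted frame. *)
Definition omega1 (R : realType) (b : 'M[R]_4) : 'M[R]_4 :=
  wedge (row 0 b) (row 1 b) - wedge (row 2 b) (row 3 b).

Definition omega2 (R : realType) (b : 'M[R]_4) : 'M[R]_4 :=
  wedge (row 0 b) (row 2 b) - wedge (row 3 b) (row 1 b).

Definition omega3 (R : realType) (b : 'M[R]_4) : 'M[R]_4 :=
  wedge (row 0 b) (row 3 b) - wedge (row 1 b) (row 2 b).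

(* The factor 1/4 makes omega^1, omega^2, omega^3 orthonormal. *)
Definition form_dot (R : realType) (eta zeta : 'M[R]_4) : R :=
  4^-1 * \tr (eta *m zeta^T).

Definition bundleE (R : realType) (M : smoothSurface R) (f : M -> 'rV[R]_4)
    (p : M) : set 'M[R]_4 :=
  [set eta | exists (b : 'M[R]_4) (k : R),
     adapted_frame f p b /\ eta = k *: omega1 b].

Definition bundleF (R : realType) (M : smoothSurface R) (f : M -> 'rV[R]_4)
    (p : M) : set 'M[R]_4 :=
  [set eta | asd eta /\ forall zeta, bundleE f p zeta -> form_dot eta zeta = 0].

Definition wedge3 (R : realType) (T : Type) (a b c : T -> R) (u v w : T) : R :=
  a u * (b v * c w - b w * c v) - a v * (b u * c w - b w * c u)
  + a w * (b u * c v - b v * c u).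

(* Tangent vectors of the total space are pairs (x, eta) with [asd eta]; the
   dual coframe is that of the standard frame of R^4. *)
Definition phi (R : realType) (u v w : 'rV[R]_4 * 'M[R]_4) : R :=
  let e i := fun x : 'rV[R]_4 * 'M[R]_4 => dot x.1 (std_e R i) in
  let o1 := fun x : 'rV[R]_4 * 'M[R]_4 => form_dot x.2 (omega1 1%:M) in
  let o2 := fun x : 'rV[R]_4 * 'M[R]_4 => form_dot x.2 (omega2 1%:M) in
  let o3 := fun x : 'rV[R]_4 * 'M[R]_4 => form_dot x.2 (omega3 1%:M) in
  wedge3 o1 o2 o3 u v w
  + (wedge3 o1 (e 0) (e 1) u v w - wedge3 o1 (e 2) (e 3) u v w)
  + (wedge3 o2 (e 0) (e 2) u v w - wedge3 o2 (e 3) (e 1) u v w)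
  + (wedge3 o3 (e 0) (e 3) u v w - wedge3 o3 (e 1) (e 2) u v w).

(* The tangent space at (p, eta) of the total space of F, immersed by
   (q, zeta) |-> (f q, zeta): velocities of smooth curves in F. *)
Definition tangent_total (R : realType) (M : smoothSurface R)
    (f : M -> 'rV[R]_4) (p : M) (eta : 'M[R]_4) : set ('rV[R]_4 * 'M[R]_4) :=
  [set v | exists (I : set R) (c : R -> M) (s : R -> 'M[R]_4),
     [/\ [/\ open I, I 0, smooth_curve I c & smooth_on I s],
         c 0 = p /\ s 0 = eta,
         (forall t, I t -> bundleF f (c t) (s t)) &
         v = (derive1 (f \o c) 0, derive1 s 0)]].

(* Coassociative: the G2 3-form [phi] restricts to zero on the total space
   of F, which is 4-dimensional. *)
Definition total_space_coassociative (R : realType) (M : smoothSurface R)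
    (f : M -> 'rV[R]_4) : Prop :=
  forall (p : M) (eta : 'M[R]_4), bundleF f p eta ->
    forall u v w, tangent_total f p eta u -> tangent_total f p eta v ->
      tangent_total f p eta w -> phi u v w = 0.

(* Main.v *)
(* Let (b_0, b_1, b_2, b_3) be an adapted frame along a curve of M, with
   connection coefficients A_ij = <b_i', b_j>. An anti-self-dual form lies in
   F exactly when it vanishes on (b_0, b_1). Differentiating this equation along
   a curve of forms s in F gives, with x = s(b_0, b_2) and y = s(b_0, b_3),
     s'(b_0, b_1) = x (A_03 - A_12) - y (A_13 + A_02).
   On anti-self-dual forms phi is a determinant plus evaluation terms, so the
   total space is coassociative exactly when s' always stays orthogonal to
   omega^1, i.e. when A_03 = A_12 and A_13 = - A_02. Since the component of
   A^nu along b_i is - <nu, b_i'>, these are also the equations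
   A^{J nu} = - J A^nu. *)
Require Import Defs.
From mathcomp Require Import all_boot all_order all_algebra.
From mathcomp Require Import all_classical all_reals all_analysis.
From mathcomp Require Import ring lra.
Import Order.TTheory GRing.Theory Num.Theory.
Import numFieldNormedType.Exports.
Set Implicit Arguments.
Unset Strict Implicit.
Unset Printing Implicit Defensive.
Local Open Scope classical_set_scope.
Local Open Scope ring_scope.

(** * Anti-self-dual forms in an oriented orthonormal frame *)

(** Tangent vectors, of the surface and of the total space, are given only as velocities of curves,
    so all computations run along one curve. Injectivity of the differential makes the shape
    operator independent of the curve that computes it. The formula for s'(b_0, b_1) is linear in
    (x, y). The sections [omega2] and [omega3] of the moving frame have (x, y) = (1, 0) and (0, 1)
    and separate the two equations. Their velocities are tested against two vertical vectors: every
    evaluation term of phi then has a zero argument, and what remains is a determinant that reads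
    off the omega^1 component. Conversely, once the equations hold, all fibre velocities lie in the
    plane F_p and all horizontal parts in T_p M, on which forms of F vanish; the determinant and the
    evaluation terms vanish separately. Both directions need a smooth adapted frame near each point.
    It comes from Gram-Schmidt, which is why [Ck] is shown to be stable under products, inverse
    square roots and composition. *)

Lemma sum4 (V : nmodType) (F : 'I_4 -> V) :
  \sum_i F i = F 0 + F 1 + F 2 + F 3.
Proof.
rewrite !big_ord_recl big_ord0 addr0 !addrA.
do !congr (_ + _); congr F; exact/val_inj.
Qed.

Lemma forall4 (P : 'I_4 -> Prop) : P 0 -> P 1 -> P 2 -> P 3 -> forall i, P i.
Proof.
move=> P0 P1 P2 P3 i.
have : i \in [:: 0; 1; 2; 3 : 'I_4] by case: i => [[|[|[|[|i]]]]] //.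
by rewrite !inE => /or4P[] /eqP ->.
Qed.

Lemma dotE (R : realType) (x y : 'rV[R]_4) :
  dot x y = x 0 0 * y 0 0 + x 0 1 * y 0 1 + x 0 2 * y 0 2 + x 0 3 * y 0 3.
Proof. by rewrite /dot mxE sum4 !mxE. Qed.

Lemma wedgeE (R : realType) (x y : 'rV[R]_4) i j :
  wedge x y i j = x 0 i * y 0 j - y 0 i * x 0 j.
Proof. by rewrite !mxE !big_ord1 !mxE. Qed.

Lemma std_eE (R : realType) i j : (std_e R i) 0 j = (i == j)%:R.
Proof. by rewrite !mxE. Qed.

Lemma form_dotE (R : realType) (eta zeta : 'M[R]_4) :
  form_dot eta zeta = 4^-1 * \sum_i \sum_j eta i j * zeta i j.
Proof.
congr (_ * _); apply: eq_bigr => i _; rewrite mxE; apply: eq_bigr => j _.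
by rewrite mxE.
Qed.

Lemma hodge_entry (R : realType) (eta : 'M[R]_4) i j :
  let e := fun k l => (k == l)%:R : R in
  let w := fun k l => e k i * e l j - e l i * e k j in
  hodge eta i j = eta 2 3 * w 0 1 + eta 3 1 * w 0 2 + eta 1 2 * w 0 3
    + eta 0 1 * w 2 3 + eta 0 2 * w 3 1 + eta 0 3 * w 1 2.
Proof.
have D (A B : 'M[R]_4) : (A + B) i j = A i j + B i j by rewrite mxE.
have Z k (A : 'M[R]_4) : (k *: A) i j = k * A i j by rewrite mxE.
by move=> e w; rewrite /hodge !D !Z !wedgeE !std_eE.
Qed.

(** The Hodge equation has six independent entries, but they pair up: the entries 23, 31, 12 repeat
    the entries 01, 02, 03. *)
Lemma asdP (R : realType) (eta : 'M[R]_4) : asd eta <->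
  (forall i j, eta j i = - eta i j) /\
  [/\ eta 2 3 = - eta 0 1, eta 3 1 = - eta 0 2 & eta 1 2 = - eta 0 3].
Proof.
split=> [[sk ho]|[sk [h1 h2 h3]]].
  split=> [i j|]; first by move/matrixP: sk => /(_ i j); rewrite !mxE.
  move/matrixP: ho => ho.
  move: (ho 0 1) (ho 0 2) (ho 0 3); rewrite !hodge_entry /= !(mxE _ _ 0).
  by split; lra.
split; first by apply/matrixP => i j; rewrite !mxE sk.
have d i : eta i i = 0 by have := sk i i; lra.
apply/matrixP; do 2!apply: forall4; rewrite hodge_entry mxE /= ?d;
  rewrite ?(sk 0 1) ?(sk 0 2) ?(sk 0 3) ?(sk 1 2) ?(sk 1 3) ?(sk 2 3);
  move: h1 h2 h3; rewrite ?(sk 1 3); lra.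
Qed.

(** Laplace expansion along the first two rows. This form displays the determinant as the pairing of
    the 2-vectors of x, y and of z, t. *)
Definition det4 (R : realType) (x y z t : 'rV[R]_4) : R :=
  let m i j := z 0 i * t 0 j - z 0 j * t 0 i in
  let n i j := x 0 i * y 0 j - x 0 j * y 0 i in
  n 0 1 * m 2 3 - n 0 2 * m 1 3 + n 0 3 * m 1 2
  + n 1 2 * m 0 3 - n 1 3 * m 0 2 + n 2 3 * m 0 1.

Lemma det_row4 (R : realType) (b : 'M[R]_4) :
  \det b = det4 (row 0 b) (row 1 b) (row 2 b) (row 3 b).
Proof.
rewrite /det4 !mxE.
(* Indexing by natural numbers lets the lifted ordinals of the cofactor expansion and the numerals 0
   to 3 compute to the same indices. *)
pose B m n := b (inord m) (inord n).
have bE (i j : 'I_4) : b i j = B i j by rewrite /B !inord_val.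
do 3!rewrite !(expand_det_row _ ord0) !big_ord_recl !big_ord0 /cofactor.
by rewrite !det_mx11 !mxE !bE /= /bump /=; ring.
Qed.

Lemma gram_wedge_det (R : realType) (x y z t : 'rV[R]_4) :
  let p i j := x 0 i * y 0 j - y 0 i * x 0 j in
  let q i j := z 0 i * t 0 j - t 0 i * z 0 j in
  (p 0 1 - q 2 3) ^+ 2 + (p 0 2 - q 3 1) ^+ 2 + (p 0 3 - q 1 2) ^+ 2
  + (p 1 2 - q 0 3) ^+ 2 + (p 3 1 - q 0 2) ^+ 2 + (p 2 3 - q 0 1) ^+ 2
  = (dot x x * dot y y - dot x y ^+ 2) + (dot z z * dot t t - dot z t ^+ 2)
    - det4 x y z t *+ 2.
Proof. by move=> p q; rewrite /det4 !dotE /p /q; ring. Qed.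

(* The squared distance between [hodge (x /\ y)] and [z /\ t] is
   [gram x y + gram z t - 2 det]. *)
Lemma hodge_wedge (R : realType) (x y z t : 'rV[R]_4) :
  dot x x = 1 -> dot y y = 1 -> dot z z = 1 -> dot t t = 1 ->
  dot x y = 0 -> dot z t = 0 -> det4 x y z t = 1 ->
  hodge (wedge x y) = wedge z t.
Proof.
move=> xx yy zz tt xy zt d.
have /= := gram_wedge_det x y z t; rewrite xx yy zz tt xy zt d => S.
have sq0 (a : R) : a ^+ 2 <= 0 -> a = 0.
  by move=> a0; apply/eqP; rewrite -sqrf_eq0 eq_le a0 sqr_ge0.
set a1 := (X in X ^+ 2 + _ + _ + _ + _ + _ = _) in S.
set a2 := (X in _ + X ^+ 2 + _ + _ + _ + _ = _) in S.
set a3 := (X in _ + X ^+ 2 + _ + _ + _ = _) in S.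
set a4 := (X in _ + X ^+ 2 + _ + _ = _) in S.
set a5 := (X in _ + X ^+ 2 + _ = _) in S.
set a6 := (X in _ + X ^+ 2 = _) in S.
have [p1 p2 p3] : [/\ 0 <= a1 ^+ 2, 0 <= a2 ^+ 2 & 0 <= a3 ^+ 2].
  by split; exact: sqr_ge0.
have [p4 p5 p6] : [/\ 0 <= a4 ^+ 2, 0 <= a5 ^+ 2 & 0 <= a6 ^+ 2].
  by split; exact: sqr_ge0.
have /sq0 e1 : a1 ^+ 2 <= 0 by lra.
have /sq0 e2 : a2 ^+ 2 <= 0 by lra.
have /sq0 e3 : a3 ^+ 2 <= 0 by lra.
have /sq0 e4 : a4 ^+ 2 <= 0 by lra.
have /sq0 e5 : a5 ^+ 2 <= 0 by lra.
have /sq0 e6 : a6 ^+ 2 <= 0 by lra.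
clear S p1 p2 p3 p4 p5 p6; rewrite /a1 /a2 /a3 /a4 /a5 /a6 in e1 e2 e3 e4 e5 e6.
apply/matrixP; do 2!apply: forall4; rewrite hodge_entry !wedgeE /=; lra.
Qed.

Definition oframe (R : realType) (b : 'M[R]_4) : Prop :=
  b *m b^T = 1%:M /\ 0 < \det b.

Lemma dot_row (R : realType) (b : 'M[R]_4) i j : b *m b^T = 1%:M ->
  dot (row i b) (row j b) = (i == j)%:R.
Proof.
move=> /matrixP /(_ i j); rewrite !mxE => <-.
by rewrite /dot !mxE; apply: eq_bigr => k _; rewrite !mxE.
Qed.

Lemma oframe_det (R : realType) (b : 'M[R]_4) : oframe b -> \det b = 1.
Proof.
move=> [orth d]; have := congr1 determinant orth.
rewrite det_mulmx det_tr det1 => /eqP; rewrite -expr2 sqrf_eq1.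
by case/orP => /eqP // e; move: d; rewrite e; lra.
Qed.

(** In all six cases the four rows appear in an even permutation, so the determinant required by
    [hodge_wedge] is still 1. *)
Lemma hodge_oframe (R : realType) (b : 'M[R]_4) : oframe b ->
  let w i j := wedge (row i b) (row j b) in
  [/\ hodge (w 0 1) = w 2 3, hodge (w 0 2) = w 3 1 & hodge (w 0 3) = w 1 2] /\
  [/\ hodge (w 2 3) = w 0 1, hodge (w 3 1) = w 0 2 & hodge (w 1 2) = w 0 3].
Proof.
move=> bP w; have := oframe_det bP; rewrite det_row4 /det4 => d.
by do 2!split; apply: hodge_wedge; rewrite ?(dot_row _ _ bP.1) //= /det4 -d; ring.
Qed.

Lemma wedge_skew (R : realType) (x y : 'rV[R]_4) : (wedge x y)^T = - wedge x y.
Proof. by rewrite /wedge linearB /= !trmx_mul !trmxK opprB. Qed.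

Lemma hodgeB (R : realType) (eta zeta : 'M[R]_4) :
  hodge (eta - zeta) = hodge eta - hodge zeta.
Proof.
apply/matrixP => i j; rewrite [RHS]mxE [(- hodge zeta) i j]mxE.
by rewrite !hodge_entry !mxE; ring.
Qed.

Lemma asd_wedge (R : realType) (x y z t : 'rV[R]_4) :
  hodge (wedge x y) = wedge z t -> hodge (wedge z t) = wedge x y ->
  asd (wedge x y - wedge z t).
Proof.
move=> h1 h2; split; last by rewrite hodgeB h1 h2 [RHS]opprB.
rewrite (linearB _ (wedge x y) (wedge z t)) /=.
by rewrite (wedge_skew x y) (wedge_skew z t) [RHS]opprD.
Qed.

Lemma asd_omega (R : realType) (b : 'M[R]_4) : oframe b ->
  [/\ asd (omega1 b), asd (omega2 b) & asd (omega3 b)].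
Proof. by case/hodge_oframe => [[? ? ?] [? ? ?]]; split; apply: asd_wedge. Qed.

Definition form_val (R : realType) (eta : 'M[R]_4) (x y : 'rV[R]_4) : R :=
  dot (x *m eta) y.

Lemma form_valE (R : realType) (eta : 'M[R]_4) (x y : 'rV[R]_4) :
  form_val eta x y = \sum_i \sum_j x 0 i * eta i j * y 0 j.
Proof.
rewrite exchange_big /form_val /dot mxE /=; apply: eq_bigr => j _.
by rewrite !mxE mulr_suml.
Qed.

Lemma form_val_wedge (R : realType) (x y u v : 'rV[R]_4) :
  form_val (wedge x y) u v = dot x u * dot y v - dot y u * dot x v.
Proof. by rewrite form_valE !dotE !sum4 !wedgeE; ring. Qed.

Lemma form_val_skew (R : realType) (eta : 'M[R]_4) (x y : 'rV[R]_4) :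
  eta^T = - eta -> form_val eta y x = - form_val eta x y.
Proof.
move=> sk; rewrite /form_val /dot.
have <- : (x *m eta *m y^T)^T 0 0 = (x *m eta *m y^T) 0 0 by rewrite mxE.
by rewrite !trmx_mul trmxK sk mulNmx mulmxN [X in - X]mxE opprK mulmxA.
Qed.

Lemma form_dot_wedge (R : realType) (eta : 'M[R]_4) (x y : 'rV[R]_4) :
  eta^T = - eta -> form_dot eta (wedge x y) = 2^-1 * form_val eta x y.
Proof.
move=> sk; have yx := form_val_skew x y sk.
have -> : form_dot eta (wedge x y) = 4^-1 * (form_val eta x y - form_val eta y x).
  by rewrite form_dotE !form_valE !sum4 !wedgeE; ring.
by rewrite yx; field.
Qed.

Lemma form_dotBr (R : realType) (eta zeta xi : 'M[R]_4) :
  form_dot eta (zeta - xi) = form_dot eta zeta - form_dot eta xi.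
Proof. by rewrite /form_dot linearB /= mulmxBr linearB /= mulrBr. Qed.

Lemma hodge_selfadjoint (R : realType) (eta : 'M[R]_4) (x y : 'rV[R]_4) :
  eta^T = - eta ->
  form_dot (hodge eta) (wedge x y) = form_dot eta (hodge (wedge x y)).
Proof.
move=> sk; have {}sk i j : eta j i = - eta i j.
  by move/matrixP: sk => /(_ i j); rewrite !mxE.
have d i : eta i i = 0 by have := sk i i; lra.
rewrite !form_dotE !sum4 !hodge_entry !wedgeE /= ?d.
by rewrite (sk 0 1) (sk 0 2) (sk 0 3) (sk 1 2) (sk 1 3) (sk 2 3); ring.
Qed.

(** The star is self-adjoint, so it can be moved from the pair of vectors onto [eta], where it acts
    as -1. *)
Lemma asd_hodge_val (R : realType) (eta : 'M[R]_4) (x y z t : 'rV[R]_4) :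
  asd eta -> hodge (wedge x y) = wedge z t ->
  form_val eta z t = - form_val eta x y.
Proof.
move=> [sk ho] h; have := hodge_selfadjoint x y sk.
rewrite h ho !form_dot_wedge //; last by rewrite linearN /= sk.
have -> : form_val (- eta) x y = - form_val eta x y.
  by rewrite /form_val /dot mulmxN mulNmx mxE.
lra.
Qed.

Lemma form_dot_omega (R : realType) (eta b : 'M[R]_4) : oframe b -> asd eta ->
  [/\ form_dot eta (omega1 b) = form_val eta (row 0 b) (row 1 b),
      form_dot eta (omega2 b) = form_val eta (row 0 b) (row 2 b)
    & form_dot eta (omega3 b) = form_val eta (row 0 b) (row 3 b)].
Proof.
move=> /hodge_oframe [[h1 h2 h3] _] a; have sk := a.1.
have e1 := asd_hodge_val a h1; have e2 := asd_hodge_val a h2.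
have e3 := asd_hodge_val a h3.
by split; rewrite form_dotBr !form_dot_wedge // ?e1 ?e2 ?e3; lra.
Qed.

(** The matrix of [eta] in the frame is [b *m eta *m b^T]. By skewness and [asd_hodge_val] its
    entries 01, 02, 03 determine it, and changing basis back gives the expansion. *)
Lemma asd_expand (R : realType) (eta b : 'M[R]_4) : oframe b -> asd eta ->
  eta = form_val eta (row 0 b) (row 1 b) *: omega1 b
      + form_val eta (row 0 b) (row 2 b) *: omega2 b
      + form_val eta (row 0 b) (row 3 b) *: omega3 b.
Proof.
move=> bP a; have [[h1 h2 h3] _] := hodge_oframe bP.
have bb : b^T *m b = 1%:M by exact: mulmx1C bP.1.
pose m i j := form_val eta (row i b) (row j b).
have mE i j : (b *m eta *m b^T) i j = m i j.
  by rewrite /m /form_val /dot -row_mul !mxE; apply: eq_bigr => k _; rewrite !mxE.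
have sk i j : m j i = - m i j := form_val_skew _ _ a.1.
have e1 : m 2 3 = - m 0 1 := asd_hodge_val a h1.
have e2 : m 3 1 = - m 0 2 := asd_hodge_val a h2.
have e3 : m 1 2 = - m 0 3 := asd_hodge_val a h3.
have d i : m i i = 0 by have := sk i i; lra.
have E : eta = b^T *m (b *m eta *m b^T) *m b.
  by rewrite !mulmxA bb mul1mx -mulmxA bb mulmx1.
rewrite -/(m 0 1) -/(m 0 2) -/(m 0 3) [LHS]E.
move: m (b *m eta *m b^T) mE sk e1 e2 e3 d {E h1 h2 h3} => m A mE sk e1 e2 e3 d.
apply/matrixP => k l; rewrite [LHS]mxE sum4.
have S j : (b^T *m A) k j = b 0 k * m 0 j + b 1 k * m 1 j + b 2 k * m 2 j + b 3 k * m 3 j.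
  by rewrite mxE sum4 !mE !mxE.
rewrite !S !d (sk 0 1) (sk 0 2) (sk 0 3) (sk 1 2) (sk 2 3) (sk 3 1) e1 e2 e3.
have D (A1 A2 : 'M[R]_4) : (A1 + A2) k l = A1 k l + A2 k l by rewrite mxE.
have Z r (A1 : 'M[R]_4) : (r *: A1) k l = r * A1 k l by rewrite mxE.
have N (A1 : 'M[R]_4) : (- A1) k l = - A1 k l by rewrite mxE.
rewrite /omega1 /omega2 /omega3 !(wedgeE, D, Z, N) !mxE.
ring.
Qed.

(** The entries 01, 02, 03 of an anti-self-dual matrix are its coordinates in the standard basis
    omega^1, omega^2, omega^3, so this is the volume form of the fibre. *)
Definition asd_det (R : realType) (a b c : 'M[R]_4) : R :=
  a 0 1 * (b 0 2 * c 0 3 - b 0 3 * c 0 2)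
  - a 0 2 * (b 0 1 * c 0 3 - b 0 3 * c 0 1)
  + a 0 3 * (b 0 1 * c 0 2 - b 0 2 * c 0 1).

Lemma form_dot_asd (R : realType) (eta zeta : 'M[R]_4) : asd eta -> asd zeta ->
  form_dot eta zeta = eta 0 1 * zeta 0 1 + eta 0 2 * zeta 0 2 + eta 0 3 * zeta 0 3.
Proof.
move=> /asdP [sk [h1 h2 h3]] /asdP [sk' [h1' h2' h3']].
have d i : eta i i = 0 by have := sk i i; lra.
rewrite form_dotE !sum4 !d (sk 0 1) (sk 0 2) (sk 0 3) (sk 1 2) (sk 3 1) (sk 2 3).
rewrite (sk' 0 1) (sk' 0 2) (sk' 0 3) (sk' 1 2) (sk' 3 1) (sk' 2 3).
by rewrite h1 h2 h3 h1' h2' h3'; field.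
Qed.

Lemma oframe1 (R : realType) : oframe (1%:M : 'M[R]_4).
Proof. by rewrite /oframe trmx1 mulmx1 det1; split => //; lra. Qed.

Lemma form_val_std (R : realType) (eta : 'M[R]_4) i j :
  form_val eta (row i 1%:M) (row j 1%:M) = eta i j.
Proof.
rewrite /form_val /dot -row_mul mul1mx mxE (bigD1 j) //= big1 => [|k kj].
  by rewrite !mxE eqxx mulr1 addr0.
by rewrite !mxE eq_sym (negPf kj) mulr0.
Qed.

(** The mixed terms of [phi] add up to evaluations of each form on the other two horizontal parts,
    which no longer refer to a frame. The determinant keeps the standard basis; below, only whether
    it vanishes matters. *)
Lemma phi_asd (R : realType) (x y z : 'rV[R]_4) (eta zeta xi : 'M[R]_4) :
  asd eta -> asd zeta -> asd xi ->
  phi (x, eta) (y, zeta) (z, xi) =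
  asd_det eta zeta xi + form_val eta y z + form_val zeta z x + form_val xi x y.
Proof.
move=> a1 a2 a3.
have [E1 E2 E3] := form_dot_omega (oframe1 R) a1.
have [F1 F2 F3] := form_dot_omega (oframe1 R) a2.
have [G1 G2 G3] := form_dot_omega (oframe1 R) a3.
rewrite /phi /wedge3 /= !(E1, E2, E3, F1, F2, F3, G1, G2, G3).
rewrite !form_val_std !dotE !std_eE /= /asd_det !form_valE !sum4.
clear E1 E2 E3 F1 F2 F3 G1 G2 G3.
have [s1 [p1 q1 r1]] := (asdP eta).1 a1.
have [s2 [p2 q2 r2]] := (asdP zeta).1 a2.
have [s3 [p3 q3 r3]] := (asdP xi).1 a3.
have d1 i : eta i i = 0 by have := s1 i i; lra.
have d2 i : zeta i i = 0 by have := s2 i i; lra.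
have d3 i : xi i i = 0 by have := s3 i i; lra.
rewrite !d1 !d2 !d3.
rewrite (s1 0 1) (s1 0 2) (s1 0 3) (s1 1 2) (s1 3 1) (s1 2 3) p1 q1 r1.
rewrite (s2 0 1) (s2 0 2) (s2 0 3) (s2 1 2) (s2 3 1) (s2 2 3) p2 q2 r2.
rewrite (s3 0 1) (s3 0 2) (s3 0 3) (s3 1 2) (s3 3 1) (s3 2 3) p3 q3 r3.
ring.
Qed.

Lemma form_valB (R : realType) (eta zeta : 'M[R]_4) (x y : 'rV[R]_4) :
  form_val (eta - zeta) x y = form_val eta x y - form_val zeta x y.
Proof. by rewrite /form_val /dot mulmxBr mulmxBl !mxE. Qed.

Lemma form_val_omega (R : realType) (b : 'M[R]_4) : oframe b ->
  let v eta i := form_val eta (row 0 b) (row i b) in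
  [/\ v (omega1 b) 1 = 1, v (omega1 b) 2 = 0 & v (omega1 b) 3 = 0] /\
  [/\ v (omega2 b) 1 = 0, v (omega2 b) 2 = 1 & v (omega2 b) 3 = 0] /\
  [/\ v (omega3 b) 1 = 0, v (omega3 b) 2 = 0 & v (omega3 b) 3 = 1].
Proof.
move=> bP v; rewrite /v /omega1 /omega2 /omega3.
rewrite !(form_valB (wedge _ _) (wedge _ _)) !form_val_wedge.
by rewrite !(dot_row _ _ bP.1) /=; do !split; ring.
Qed.

(* The Gram matrix of [omega1 b, omega2 b, omega3 b] is the identity. *)
Lemma asd_det_omega (R : realType) (b : 'M[R]_4) : oframe b ->
  asd_det (omega1 b) (omega2 b) (omega3 b) != 0.
Proof.
move=> bP; have [a1 a2 a3] := asd_omega bP.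
have [E1 E2 E3] := form_dot_omega bP a1.
have [_ F2 F3] := form_dot_omega bP a2.
have [_ _ G3] := form_dot_omega bP a3.
have [[v1 v2 v3] [[_ v5 v6] [_ _ v9]]] := form_val_omega bP.
move: E1 E2 E3 F2 F3 G3; rewrite v1 v2 v3 v5 v6 v9 !form_dot_asd //.
rewrite /asd_det; move: (omega1 b) (omega2 b) (omega3 b) => p q r.
move=> E1 E2 E3 F2 F3 G3.
apply/eqP => d0; suff : (1 : R) = 0 by lra.
pose g (a a' : 'M[R]_4) : R := a 0 1 * a' 0 1 + a 0 2 * a' 0 2 + a 0 3 * a' 0 3.
(* The determinant of the Gram matrix is 1 by orthonormality and [d ^+ 2] by multiplicativity. *)
transitivity (g p p * (g q q * g r r - g q r * g q r)
  - g p q * (g p q * g r r - g q r * g p r)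
  + g p r * (g p q * g q r - g q q * g p r)).
  by rewrite /g E1 E2 E3 F2 F3 G3; ring.
set d := (X in X = 0) in d0.
transitivity (d ^+ 2); last by rewrite d0 expr0n.
by rewrite /d /g; ring.
Qed.

Lemma asd_det_comb (R : realType) (p q r : 'M[R]_4) (x y z : R) :
  asd_det q r (x *: p + y *: q + z *: r) = x * asd_det p q r.
Proof. by rewrite /asd_det !mxE; ring. Qed.

Lemma asd_det_plane (R : realType) (q r : 'M[R]_4) (x1 y1 x2 y2 x3 y3 : R) :
  asd_det (x1 *: q + y1 *: r) (x2 *: q + y2 *: r) (x3 *: q + y3 *: r) = 0.
Proof. by rewrite /asd_det !mxE; ring. Qed.

(** With [omega2] and [omega3] in two slots the determinant sees only the [omega1] component of
    [xi], multiplied by a nonzero factor. *)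
Lemma asd_det_vertical (R : realType) (b xi : 'M[R]_4) : oframe b -> asd xi ->
  asd_det (omega2 b) (omega3 b) xi = 0 ->
  form_val xi (row 0 b) (row 1 b) = 0.
Proof.
move=> bP a; rewrite {1}(asd_expand bP a) asd_det_comb => /eqP.
by rewrite mulf_eq0 (negPf (asd_det_omega bP)) orbF => /eqP.
Qed.

Lemma form_val_tangent (R : realType) (b eta : 'M[R]_4) (x y : 'rV[R]_4)
    (x0 x1 y0 y1 : R) : eta^T = - eta ->
  form_val eta (row 0 b) (row 1 b) = 0 ->
  x = x0 *: row 0 b + x1 *: row 1 b -> y = y0 *: row 0 b + y1 *: row 1 b ->
  form_val eta x y = 0.
Proof.
move=> sk v0 -> ->.
have v1 := form_val_skew (row 0 b) (row 1 b) sk.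
have v2 i := form_val_skew (row i b) (row i b) sk.
have L k1 k2 (u1 u2 u : 'rV[R]_4) : form_val eta (k1 *: u1 + k2 *: u2) u
    = k1 * form_val eta u1 u + k2 * form_val eta u2 u.
  by rewrite /form_val /dot !mulmxDl -!scalemxAl !mxE.
have L' k1 k2 (u1 u2 u : 'rV[R]_4) : form_val eta u (k1 *: u1 + k2 *: u2)
    = k1 * form_val eta u u1 + k2 * form_val eta u u2.
  by rewrite form_val_skew // L !(form_val_skew u) //; ring.
have d0 : form_val eta (row 0 b) (row 0 b) = 0 by have := v2 0; lra.
have d1 : form_val eta (row 1 b) (row 1 b) = 0 by have := v2 1; lra.
by rewrite L !L' v1 v0 d0 d1; ring.
Qed.

(** The three forms lie in the plane of [omega2] and [omega3], which kills the determinant. Each of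
    them vanishes on the plane of rows 0 and 1, which kills the evaluations. *)
Lemma phi_horizontal_eq0 (R : realType) (b : 'M[R]_4) (u v w : 'rV[R]_4 * 'M[R]_4) :
  oframe b ->
  (forall t, t = u \/ t = v \/ t = w ->
    [/\ asd t.2, form_val t.2 (row 0 b) (row 1 b) = 0 &
        exists k0 k1, t.1 = k0 *: row 0 b + k1 *: row 1 b]) ->
  phi u v w = 0.
Proof.
move=> bP H; have [a1 p1 [k0 [k1 E1]]] := H u (or_introl erefl).
have [a2 p2 [l0 [l1 E2]]] := H v (or_intror (or_introl erefl)).
have [a3 p3 [m0 [m1 E3]]] := H w (or_intror (or_intror erefl)).
case: u v w {H} => x eta [y zeta] [z xi] in a1 p1 E1 a2 p2 E2 a3 p3 E3 *.
rewrite /= in a1 p1 E1 a2 p2 E2 a3 p3 E3; rewrite phi_asd //.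
rewrite (form_val_tangent a1.1 p1 E2 E3) (form_val_tangent a2.1 p2 E3 E1).
rewrite (form_val_tangent a3.1 p3 E1 E2) !addr0.
rewrite (asd_expand bP a1) (asd_expand bP a2) (asd_expand bP a3) p1 p2 p3.
by rewrite !scale0r !add0r asd_det_plane.
Qed.

(** * Calculus of smooth maps *)

Section Ck_theory.
Variable R : realType.

Lemma near_eq_differentiable (V W : normedModType R) (f g : V -> W) (a : V) :
  (\near a, f a = g a) -> differentiable f a -> differentiable g a.
Proof.
move=> fg df; have fga := nbhs_singleton fg.
have H : g \o shift a = cst (g a) + 'd f a +o_ 0 id.
  apply/eqaddoP => e e0; have /eqaddoP/(_ e e0) He := diff_locally df.
  have fg0 : \forall y \near 0, f (y + a) = g (y + a).
    by move: fg; rewrite (near_shift 0 a); apply: filterS => y /=; rewrite subr0.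
  by apply: filterS2 He fg0 => y /= + E; rewrite !fctE /= E fga.
(* By [H] the differential of [f] also approximates [g], so uniqueness identifies it with
   ['d g a]. *)
apply/diff_locallyP; rewrite (diff_unique (diff_continuous df) H); split => //.
exact: diff_continuous.
Qed.

Lemma Ck_continuous (V W : normedModType R) k (U : set V) (f : V -> W) :
  Ck k U f -> forall x, U x -> {for x, continuous f}.
Proof. by case: k => [//|k] [df _] x /df; exact: differentiable_continuous. Qed.

Lemma open_near (T : topologicalType) (U : set T) (P : T -> Prop) x :
  open U -> U x -> (forall y, U y -> P y) -> \near x, P x.
Proof. by move=> oU Ux UP; apply: filterS UP _; exact: open_nbhs_nbhs. Qed.

(** Derivatives depend on germs; openness of [U] turns equality on [U] into equality near each of
    its points. *)
Lemma Ck_eq (V W : normedModType R) k (U : set V) (f g : V -> W) : open U ->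
  (forall x, U x -> f x = g x) -> Ck k U f -> Ck k U g.
Proof.
move=> oU; elim: k f g => [|k IH] f g fg /=.
  move=> cf x Ux; rewrite /prop_for /continuous_at -fg //.
  apply: cvg_trans (cf x Ux); apply: near_eq_cvg.
  exact: open_near fg.
move=> [df ck]; split=> [x Ux|v].
  by apply: near_eq_differentiable (df x Ux); exact: open_near fg.
apply: IH (ck v) => x Ux.
by apply: near_eq_derive; exact: open_near fg.
Qed.

Lemma Ck_sub (V W : normedModType R) k (U U' : set V) (f : V -> W) :
  U' `<=` U -> Ck k U f -> Ck k U' f.
Proof.
move=> sU; elim: k f => [|k IH] f /= => [cf x /sU /cf //|[df ck]].
by split=> [x /sU /df //|v]; exact: IH.
Qed.

Lemma CkW (V W : normedModType R) k (U : set V) (f : V -> W) :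
  Ck k.+1 U f -> Ck k U f.
Proof.
elim: k f => [|k IH] f; first exact: Ck_continuous.
by move=> [df ck]; split => // v; exact: IH.
Qed.

Lemma Ck_cst (V W : normedModType R) k (U : set V) (a : W) : Ck k U (fun=> a).
Proof.
elim: k a => [|k IH] a /=; first by move=> x _; exact: cst_continuous.
split=> [x _|v]; first exact: differentiable_cst.
have -> : (fun x : V => 'D_v (fun=> a) x) = (fun=> 0 : W).
  by apply/funext => x; exact: derive_cst.
exact: IH.
Qed.

Lemma CkD (V W : normedModType R) k (U : set V) (f g : V -> W) : open U ->
  Ck k U f -> Ck k U g -> Ck k U (fun x => f x + g x).
Proof.
move=> oU; elim: k f g => [|k IH] f g /=.
  by move=> cf cg x Ux; apply: continuousD; [exact: cf|exact: cg].
move=> [df cf] [dg cg]; split=> [x Ux|v].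
  by apply: differentiableD; [exact: df|exact: dg].
apply: Ck_eq (IH _ _ (cf v) (cg v)) => // x Ux.
by rewrite -deriveD //; apply: diff_derivable; [exact: df|exact: dg].
Qed.

Lemma CkM (V : normedModType R) k (U : set V) (f g : V -> R) : open U ->
  Ck k U f -> Ck k U g -> Ck k U (fun x => f x * g x).
Proof.
move=> oU; elim: k f g => [|k IH] f g.
  by move=> /= cf cg x Ux; apply: continuousM; [exact: cf|exact: cg].
move=> cf1 cg1; have [df cf] := cf1; have [dg cg] := cg1.
split=> [x Ux|v]; first by apply: differentiableM; [exact: df|exact: dg].
have := CkD oU (IH _ _ (CkW cf1) (cg v)) (IH _ _ (CkW cg1) (cf v)).
apply: Ck_eq => // x Ux; rewrite -[RHS]/('D_v (f * g) x) deriveM //.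
  by apply: diff_derivable; exact: df.
by apply: diff_derivable; exact: dg.
Qed.

Lemma CkN (V : normedModType R) k (U : set V) (f : V -> R) : open U ->
  Ck k U f -> Ck k U (fun x => - f x).
Proof.
move=> oU cf; have := CkM oU (Ck_cst k U (-1 : R)) cf.
by apply: Ck_eq => // x _; rewrite mulN1r.
Qed.

Lemma CkB (V : normedModType R) k (U : set V) (f g : V -> R) : open U ->
  Ck k U f -> Ck k U g -> Ck k U (fun x => f x - g x).
Proof. by move=> oU cf cg; apply: CkD => //; exact: CkN. Qed.

Lemma is_derive_invsqrt (y : R) : 0 < y ->
  is_derive y 1 (fun z : R => (Num.sqrt z)^-1) (- 2^-1 * (Num.sqrt y)^-1 ^+ 3).
Proof.
move=> y0; have s0 : Num.sqrt y != 0 by rewrite gt_eqF // sqrtr_gt0.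
have ds := is_derive1_sqrt y0.
have ds' : derivable Num.sqrt y (1 : R) by [].
apply: DeriveDef; first exact: derivableV.
rewrite deriveV // derive_val; rewrite /GRing.scale /=.
by field.
Qed.

Lemma derive_comp (V : normedModType R) (h : R -> R) (g : V -> R) x v :
  derivable h (g x) 1 -> differentiable g x ->
  'D_v (h \o g) x = 'D_1 h (g x) * 'D_v g x.
Proof.
move=> dh dg; have dh' := (derivable1_diffP _ _).1 dh.
rewrite deriveE; last exact: differentiable_comp.
by rewrite diff_comp //= deriv1E // derive1E (deriveE _ dg) [RHS]mulrC.
Qed.

(** The derivative is -1/2 times the cube of the function itself times a derivative of [g], so the
    induction on [k] closes with the product rule alone. *)
Lemma Ck_invsqrt (V : normedModType R) k (U : set V) (g : V -> R) : open U ->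
  (forall x, U x -> 0 < g x) ->
  Ck k U g -> Ck k U (fun x => (Num.sqrt (g x))^-1).
Proof.
move=> oU g0; elim: k => [|k IH] cg1.
  move=> x Ux; apply: (@continuousV _ _ (Num.sqrt \o g)) => /=.
    by rewrite gt_eqF // sqrtr_gt0 g0.
  by apply: continuous_comp; [exact: cg1|exact: sqrt_continuous].
have [dg cg] := cg1; have dh x (Ux : U x) := is_derive_invsqrt (g0 _ Ux).
split=> [x Ux|v].
  apply: (@differentiable_comp _ _ _ _ g (fun z : R => (Num.sqrt z)^-1)).
    exact: dg.
  by apply/derivable1_diffP; have := dh x Ux.
have C := IH (CkW cg1).
have C3 := CkM oU (CkM oU (CkM oU C C) C) (CkM oU (Ck_cst k U (- 2^-1 : R)) (cg v)).
apply: Ck_eq C3 => // x Ux; have d := dh x Ux.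
rewrite (derive_comp (h := fun z : R => (Num.sqrt z)^-1)) ?derive_val //.
  by ring.
exact: dg.
Qed.

End Ck_theory.

(** * Matrix-valued maps entry by entry, and the chain rule *)

Section Ck_matrix.
Variable R : realType.

Lemma differentiable_mx (V : normedModType R) m n (F : V -> 'M[R]_(m, n)) x :
  (forall i j, differentiable (fun y => F y i j) x) -> differentiable F x.
Proof.
move=> dF.
have -> : F = \sum_(i < m) \sum_(j < n) (fun y => F y i j *: delta_mx i j).
  apply/funext => y; rewrite {1}(matrix_sum_delta (F y)) fct_sumE.
  by apply: eq_bigr => i _; rewrite fct_sumE.
apply: differentiable_sum => i; apply: differentiable_sum => j.
exact: differentiableZl.
Qed.

Lemma continuous_mx (T : topologicalType) m n (F : T -> 'M[R]_(m, n)) x :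
  (forall i j, {for x, continuous (fun y => F y i j)}) ->
  {for x, continuous F}.
Proof.
move=> cF; apply/cvgrPdist_le => e e0.
near=> y; rewrite /Num.Def.normr/= mx_normrE (bigmax_le _ (ltW e0))//= => i _.
rewrite !mxE/=; move: i; near: y; apply: filter_forall => /= i.
exact: ((cvgrPdist_le _ _).1 (cF i.1 i.2)).
Unshelve. all: by end_near. Qed.

Lemma differentiable_entry (V : normedModType R) m n (F : V -> 'M[R]_(m, n)) x i j :
  differentiable F x -> differentiable (fun y => F y i j) x.
Proof.
move=> dF; apply: (@differentiable_comp _ _ _ _ F (fun N : 'M[R]_(m, n) => N i j : R)) => //.
exact: differentiable_coord.
Qed.

Lemma derive_entry (V : normedModType R) m n (F : V -> 'M[R]_(m, n)) x v i j :
  derivable F x v -> ('D_v F x) i j = 'D_v (fun y => F y i j) x.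
Proof. by move=> dF; rewrite derive_mx // mxE. Qed.

Lemma Ck_mx (V : normedModType R) m n k (U : set V) (F : V -> 'M[R]_(m.+1, n.+1)) : open U ->
  (forall i j, Ck k U (fun x => F x i j)) -> Ck k U F.
Proof.
move=> oU; elim: k F => [|k IH] F cF /=.
  by move=> x Ux; apply: continuous_mx => i j; exact: cF.
have dF x : U x -> differentiable F x.
  by move=> Ux; apply: differentiable_mx => i j; exact: (cF i j).1.
split => // v; apply: IH => i j; apply: Ck_eq ((cF i j).2 v) => // x Ux.
by rewrite derive_entry //; exact/diff_derivable/dF.
Qed.

Lemma Ck_entry (V : normedModType R) m n k (U : set V) (F : V -> 'M[R]_(m.+1, n.+1)) i j :
  open U -> Ck k U F -> Ck k U (fun x => F x i j).
Proof.
move=> oU; elim: k F => [|k IH] F /=.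
  move=> cF x Ux; apply: (@continuous_comp _ _ _ F (fun N : 'M[R]__ => N i j)).
    exact: cF.
  exact: coord_continuous.
move=> [dF cF]; split=> [x Ux|v].
  by apply: differentiable_entry; exact: dF.
apply: Ck_eq (IH _ (cF v)) => // x Ux.
by rewrite derive_entry //; exact/diff_derivable/dF.
Qed.

Lemma Ck_sum (V : normedModType R) k (U : set V) n (F : 'I_n -> V -> R) :
  open U -> (forall i, Ck k U (F i)) -> Ck k U (fun x => \sum_i F i x).
Proof.
move=> oU; elim: n F => [|n IH] F cF.
  by apply: Ck_eq (Ck_cst k U (0 : R)) => // x _; rewrite big_ord0.
apply: Ck_eq (CkD oU (cF ord0) (IH _ (fun i => cF (lift ord0 i)))) => // x _.
by rewrite big_ord_recl.
Qed.

Lemma derive_comp_rV (V W : normedModType R) n (T : V -> 'rV[R]_n.+1)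
    (h : 'rV[R]_n.+1 -> W) x v :
  differentiable T x -> differentiable h (T x) ->
  'D_v (h \o T) x = \sum_j 'D_v (fun y => T y 0 j) x *: 'D_('e_j) h (T x).
Proof.
move=> dT dh; rewrite deriveE; last exact: differentiable_comp.
rewrite diff_comp //= -(deriveE v dT) (row_sum_delta ('D_v T x)) linear_sum /=.
apply: eq_bigr => j _; rewrite linearZ /= (deriveE _ dh) derive_entry //.
exact: diff_derivable.
Qed.

(** In coordinates the chain rule is a finite sum of products of scalar functions. In each product
    one factor is handled by the induction hypothesis for a partial derivative of [h]. *)
Lemma Ck_comp (V : normedModType R) n k (U : set V) (U' : set 'rV[R]_n.+1)
    (T : V -> 'rV[R]_n.+1) (h : 'rV[R]_n.+1 -> R) : open U ->
  (forall x, U x -> U' (T x)) -> Ck k U T -> Ck k U' h -> Ck k U (h \o T).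
Proof.
move=> oU TU; elim: k h => [|k IH] h cT1 ch1.
  by move=> x Ux; apply: continuous_comp; [exact: cT1|exact/ch1/TU].
have [dT cT] := cT1; have [dh ch] := ch1; split=> [x Ux|v].
  by apply: differentiable_comp; [exact: dT|exact/dh/TU].
have C j := CkM oU (Ck_entry 0 j oU (cT v)) (IH _ (CkW cT1) (ch 'e_j)).
apply: Ck_eq (Ck_sum oU C) => // x Ux.
rewrite derive_comp_rV; [|exact: dT|exact/dh/TU].
by apply: eq_bigr => j _; rewrite derive_entry //; exact/diff_derivable/dT.
Qed.

Lemma Ck_comp_mx (V : normedModType R) n m p k (U : set V) (U' : set 'rV[R]_n.+1)
    (T : V -> 'rV[R]_n.+1) (h : 'rV[R]_n.+1 -> 'M[R]_(m.+1, p.+1)) : open U -> open U' ->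
  (forall x, U x -> U' (T x)) -> Ck k U T -> Ck k U' h -> Ck k U (h \o T).
Proof.
move=> oU oU' TU cT ch; apply: Ck_mx => // i j.
by apply: (Ck_comp (h := fun y => h y i j) oU TU cT); exact: Ck_entry.
Qed.

Lemma Ck_line (V : normedModType R) k (U : set R) (a v : V) : open U ->
  Ck k U (fun t : R => a + t *: v).
Proof.
move=> oU; apply: CkD => //; first exact: Ck_cst.
have is1 (x w : R) : is_diff x (fun t : R => t *: v) (fun t : R => t *: v).
  exact: is_diff_scalel.
case: k => [|k] /=.
  by move=> x _; apply: differentiable_continuous; have := is1 x 0.
split=> [x _|w]; first by have := is1 x 0.
apply: Ck_eq (Ck_cst k U (w *: v)) => // x _.
rewrite deriveE; last by have := is1 x 0.
by have -> := @diff_val _ _ _ _ _ _ _ (is1 x 0).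
Qed.

Lemma derive_line (V : normedModType R) (a v : V) (x : R) :
  'D_1 (fun t : R => a + t *: v) x = v.
Proof.
have D : is_diff x (fun t : R => a + t *: v) (fun t : R => 0 + t *: v) by exact: is_diffD.
rewrite deriveE; last by have := D.
by rewrite (@diff_val _ _ _ _ _ _ _ D) add0r scale1r.
Qed.

End Ck_matrix.

Lemma open_preimage_in (T T' : topologicalType) (U : set T) (W : set T') (g : T -> T') :
  open U -> open W -> (forall x, U x -> {for x, continuous g}) ->
  open (U `&` g @^-1` W).
Proof.
move=> oU oW cg; rewrite openE => x [Ux Wx]; apply: filterI.
  by apply: open_nbhs_nbhs.
by apply: (cg x Ux); exact: open_nbhs_nbhs.
Qed.

(** * Curves and tangent planes of an immersed surface *)

Section surface.
Variables (R : realType) (M : smoothSurface R).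
Implicit Types (i j : chart_index M) (p q : M) (c : R -> M).

Local Notation crd i := (@Defs.coord R M i).
Local Notation prm i := (@param R M i).
Local Notation chart_img i := (crd i @` chart_dom i).

Lemma paramK i u : chart_img i u -> chart_dom i (prm i u) /\ crd i (prm i u) = u.
Proof. by case=> q iq <-; rewrite coordK. Qed.

Lemma chart_image_open i (V : set M) : open V -> open (crd i @` (chart_dom i `&` V)).
Proof.
move=> oV; rewrite openE => _ [q [iq Vq] <-]; rewrite /interior.
have Iq : chart_img i (crd i q) by exists q.
have n1 : nbhs (crd i q) (chart_img i).
  by apply: open_nbhs_nbhs; split => //; exact: coord_open.
have n2 : nbhs (crd i q) (prm i @^-1` V).
  apply: param_continuous => //; rewrite coordK //.
  by apply: open_nbhs_nbhs.
apply: filterS2 n1 n2 => u /paramK [iu uK] Vu.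
by exists (prm i u).
Qed.

Lemma smooth_map_differentiable (W : normedModType R) (V : set M) (g : M -> W) i p :
  smooth_map V g -> chart_dom i p -> V p ->
  differentiable (g \o prm i) (crd i p).
Proof. by move=> sg ip Vp; apply: (sg i 1%N).1; exists p. Qed.

Lemma curve_near c p (V : set M) : curve_at p c -> open V -> V p ->
  \forall t \near (0 : R), V (c t).
Proof.
move=> [c0 [I [oI I0 [cc _]]]] oV Vp; have := cc 0 I0; rewrite /prop_for /continuous_at c0.
by apply; apply: open_nbhs_nbhs.
Qed.

Lemma curve_coord c p i : curve_at p c -> chart_dom i p ->
  differentiable (crd i \o c) (0 : R).
Proof.
move=> [c0 [I [oI I0 [_ sc]]]] ip; apply: (sc i 1%N).1.
by split => //=; rewrite c0.
Qed.

(** Velocities of images depend on the curve only through its velocity in the chart. *)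
Lemma curve_comp (W : normedModType R) (g : M -> W) c p i :
  curve_at p c -> chart_dom i p -> differentiable (g \o prm i) (crd i p) ->
  differentiable (g \o c) (0 : R) /\
  derive1 (g \o c) 0 = 'd (g \o prm i) (crd i p) (derive1 (crd i \o c) 0).
Proof.
move=> cp ip dg; have dc := curve_coord cp ip; have [c0 _] := cp.
(* The curve may leave the chart, so the factorisation through coordinates holds only near 0. *)
have E : \forall t \near (0 : R), ((g \o prm i) \o (crd i \o c)) t = (g \o c) t.
  apply: filterS (curve_near cp (chart_dom_open i) ip) => t it /=.
  by rewrite coordK.
have c0' : (crd i \o c) 0 = crd i p by rewrite /= c0.
have dg' : differentiable (g \o prm i) ((crd i \o c) 0) by rewrite c0'.
have D := differentiable_comp dc dg'.
split; first exact: near_eq_differentiable E D.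
rewrite derive1E -(near_eq_derive _ E) (deriveE _ D) (diff_comp dc dg') c0'.
by rewrite (derive1E' dc).
Qed.

(** A curve with prescribed coordinate velocity. It is meaningful only while the line stays in the
    chart image, and smoothness is claimed on that open set of times. *)
Definition chart_line i p (v : 'rV[R]_2) (t : R) : M := prm i (crd i p + t *: v).

Lemma chart_line_domain i p v : open [set t : R | chart_img i (crd i p + t *: v)].
Proof.
apply: (open_comp (f := fun t : R => crd i p + t *: v) (D := chart_img i)).
  by move=> t _; exact: (Ck_continuous (Ck_line 0 (crd i p) v openT)).
exact: coord_open.
Qed.

Lemma smooth_chart_line i p v :
  smooth_curve [set t : R | chart_img i (crd i p + t *: v)] (chart_line i p v).
Proof.
pose T := fun t : R => crd i p + t *: v.
have cT k U := Ck_line k (crd i p) v (U := U).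
have cc t : chart_img i (T t) -> {for t, continuous (chart_line i p v)}.
  move=> It; apply: (@continuous_comp _ _ _ T (prm i)).
    exact: (Ck_continuous (cT 0%N _ openT)).
  exact: param_continuous.
split=> // j k.
have oU : open ([set t : R | chart_img i (T t)] `&` chart_line i p v @^-1` chart_dom j).
  rewrite openE => t [It jt]; apply: filterI.
    by apply: open_nbhs_nbhs; split => //; exact: chart_line_domain.
  apply: (cc t It); apply: open_nbhs_nbhs; split => //; exact: chart_dom_open.
rewrite -[crd j \o _]/((crd j \o prm i) \o T).
have oU' := chart_image_open (i := i) (chart_dom_open j).
apply: (Ck_comp_mx oU oU' _ (cT k _ oU) (@transition_smooth R M i j k)).
by move=> t [/paramK [it tE] jt]; exists (chart_line i p v t).
Qed.

Lemma chart_line_at i p v : chart_dom i p -> curve_at p (chart_line i p v).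
Proof.
move=> ip; split; first by rewrite /chart_line scale0r addr0 coordK.
exists [set t : R | chart_img i (crd i p + t *: v)]; split.
- exact: chart_line_domain.
- by rewrite /= scale0r addr0; exists p.
- exact: smooth_chart_line.
Qed.

Lemma chart_line_velocity i p v : chart_dom i p ->
  derive1 (crd i \o chart_line i p v) 0 = v.
Proof.
move=> ip; have E : \forall t \near (0 : R), crd i p + t *: v = (crd i \o chart_line i p v) t.
  apply: (open_near (@chart_line_domain i p v)) => [|t /paramK [_ tE]].
    by rewrite /= scale0r addr0; exists p.
  by rewrite /= tE.
by rewrite derive1E -(near_eq_derive _ E) derive_line.
Qed.

Variable f : M -> 'rV[R]_4.
Hypothesis hf : immersion f.

Lemma immersion_differentiable i p : chart_dom i p -> differentiable (f \o prm i) (crd i p).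
Proof. by move=> ip; apply: smooth_map_differentiable (hf.1) ip _. Qed.

(** Identifies the velocities of curves with the image of a linear map; linearity of the tangent
    plane is read off from this. *)
Lemma tangent_chart i p w : chart_dom i p ->
  tangent_at f p w <-> exists v, w = 'd (f \o prm i) (crd i p) v.
Proof.
move=> ip; have df := immersion_differentiable ip; split.
  move=> [c [cp ->]]; exists (derive1 (crd i \o c) 0).
  by have [_ ->] := curve_comp cp ip df.
move=> [v ->]; exists (chart_line i p v); split; first exact: chart_line_at.
by have [_ ->] := curve_comp (chart_line_at v ip) ip df; rewrite chart_line_velocity.
Qed.

Lemma tangent_comb p (k l : R) x y :
  tangent_at f p x -> tangent_at f p y -> tangent_at f p (k *: x + l *: y).
Proof.
have [i ip] := chart_cover p => /(tangent_chart _ ip) [v ->] /(tangent_chart _ ip) [v' ->].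
by apply/(tangent_chart _ ip); exists (k *: v + l *: v'); rewrite linearD !linearZ.
Qed.

(** The curve behind the value chosen by [xget] may differ from [c]. Both have the same image
    velocity, hence by injectivity of the differential the same coordinate velocity, hence the same
    derivative of [nu]. *)
Lemma nablaE (nu : M -> 'rV[R]_4) c p i : curve_at p c -> chart_dom i p ->
  differentiable (nu \o prm i) (crd i p) ->
  nabla f nu p (derive1 (f \o c) 0) = derive1 (nu \o c) 0.
Proof.
move=> cp ip dnu; rewrite /nabla; case: xgetP => [d _ [c' [cp' E ->]]|]; last first.
  by move=> /(_ (derive1 (nu \o c) 0)) []; exists c.
have df := immersion_differentiable ip.
have [_ F] := curve_comp cp ip df; have [_ F'] := curve_comp cp' ip df.
have [_ ->] := curve_comp cp ip dnu; have [_ ->] := curve_comp cp' ip dnu.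
have inj : injective ('d (f \o prm i) (crd i p)) by exact: (hf.2 i p ip).
rewrite (inj _ _ (etrans (esym F) (etrans E F'))); reflexivity.
Qed.

End surface.

(** * Product rules for matrices, scalar products and forms *)

Section mx_derivative.
Variable R : realType.

Lemma differentiable_mulmx (V : normedModType R) m n k (F : V -> 'M[R]_(m, n))
    (G : V -> 'M[R]_(n, k)) x :
  differentiable F x -> differentiable G x ->
  differentiable (fun y => F y *m G y) x.
Proof.
move=> dF dG; apply: differentiable_mx => i j.
have -> : (fun y => (F y *m G y) i j) = \sum_(l < n) (fun y => F y i l * G y l j).
  by apply/funext => y; rewrite mxE fct_sumE.
by apply: differentiable_sum => l; apply: differentiableM; exact: differentiable_entry.
Qed.

Lemma derive_mulmx (V : normedModType R) m n k (F : V -> 'M[R]_(m, n))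
    (G : V -> 'M[R]_(n, k)) x v :
  differentiable F x -> differentiable G x ->
  'D_v (fun y => F y *m G y) x = 'D_v F x *m G x + F x *m 'D_v G x.
Proof.
move=> dF dG; apply/matrixP => i j.
rewrite derive_entry; last exact/diff_derivable/differentiable_mulmx.
have -> : (fun y => (F y *m G y) i j) = \sum_(l < n) (fun y => F y i l * G y l j).
  by apply/funext => y; rewrite mxE fct_sumE.
have dFe l := diff_derivable (v := v) (differentiable_entry i l dF).
have dGe l := diff_derivable (v := v) (differentiable_entry l j dG).
rewrite derive_sum => [|l]; last exact: derivableM.
rewrite !mxE -big_split /=; apply: eq_bigr => l _.
rewrite (deriveM (dFe l) (dGe l)) (derive_entry _ _ (diff_derivable dF)).
rewrite (derive_entry _ _ (diff_derivable dG)) addrC.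
by congr (_ + _); exact: mulrC.
Qed.

Lemma differentiable_scale (V : normedModType R) m n (a : V -> R)
    (X : V -> 'M[R]_(m, n)) x :
  differentiable a x -> differentiable X x -> differentiable (fun y => a y *: X y) x.
Proof.
move=> da dX; apply: differentiable_mx => i j; under eq_fun do rewrite mxE.
by apply: differentiableM => //; exact: differentiable_entry.
Qed.

Lemma differentiable_trmx (V : normedModType R) m n (F : V -> 'M[R]_(m, n)) x :
  differentiable F x -> differentiable (fun y => (F y)^T) x.
Proof.
move=> dF; apply: differentiable_mx => i j.
by under eq_fun do rewrite mxE; exact: differentiable_entry.
Qed.

Lemma derive_trmx (V : normedModType R) m n (F : V -> 'M[R]_(m, n)) x v :
  differentiable F x -> 'D_v (fun y => (F y)^T) x = ('D_v F x)^T.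
Proof.
move=> dF; apply/matrixP => i j.
rewrite derive_entry; last exact/diff_derivable/differentiable_trmx.
rewrite mxE derive_entry; last exact: diff_derivable.
by congr ('D_v _ x); apply/funext => y; rewrite mxE.
Qed.

Lemma differentiable_row (V : normedModType R) m n (F : V -> 'M[R]_(m, n)) i x :
  differentiable F x -> differentiable (fun y => row i (F y)) x.
Proof.
move=> dF; apply: differentiable_mx => k j.
by under eq_fun do rewrite mxE; exact: differentiable_entry.
Qed.

Lemma derive_row (V : normedModType R) m n (F : V -> 'M[R]_(m, n)) i x v :
  differentiable F x -> 'D_v (fun y => row i (F y)) x = row i ('D_v F x).
Proof.
move=> dF; apply/matrixP => k j.
rewrite derive_entry; last exact/diff_derivable/differentiable_row.
rewrite mxE derive_entry; last exact: diff_derivable.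
by congr ('D_v _ x); apply/funext => y; rewrite mxE.
Qed.

Lemma differentiable_dot (V : normedModType R) (X Y : V -> 'rV[R]_4) x :
  differentiable X x -> differentiable Y x ->
  differentiable (fun y => dot (X y) (Y y)) x.
Proof.
move=> dX dY; apply: differentiable_entry; apply: differentiable_mulmx => //.
exact: differentiable_trmx.
Qed.

Lemma derive_dot (V : normedModType R) (X Y : V -> 'rV[R]_4) x v :
  differentiable X x -> differentiable Y x ->
  'D_v (fun y => dot (X y) (Y y)) x = dot ('D_v X x) (Y x) + dot (X x) ('D_v Y x).
Proof.
move=> dX dY; have dYt := differentiable_trmx dY; rewrite /dot -derive_entry.
  by rewrite derive_mulmx // derive_trmx // mxE.
exact/diff_derivable/differentiable_mulmx.
Qed.

Lemma derive_form_val (V : normedModType R) (S : V -> 'M[R]_4) (X Y : V -> 'rV[R]_4) x v :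
  differentiable S x -> differentiable X x -> differentiable Y x ->
  'D_v (fun y => form_val (S y) (X y) (Y y)) x =
    form_val ('D_v S x) (X x) (Y x) + form_val (S x) ('D_v X x) (Y x)
    + form_val (S x) (X x) ('D_v Y x).
Proof.
move=> dS dX dY; rewrite derive_dot //; last exact: differentiable_mulmx.
rewrite derive_mulmx // /form_val; congr (_ + _).
by rewrite /dot mulmxDl mxE addrC.
Qed.

Lemma derive_near_cst (V W : normedModType R) (g : V -> W) x v (a : W) :
  (\near x, g x = a) -> 'D_v g x = 0.
Proof. by move=> ga; rewrite (near_eq_derive _ ga) derive_cst. Qed.

End mx_derivative.

Lemma dotC (R : realType) (x y : 'rV[R]_4) : dot x y = dot y x.
Proof. by rewrite !dotE; ring. Qed.

Lemma dotDl (R : realType) (x y z : 'rV[R]_4) : dot (x + y) z = dot x z + dot y z.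
Proof. by rewrite /dot mulmxDl mxE. Qed.

Lemma dotZl (R : realType) (k : R) (x z : 'rV[R]_4) : dot (k *: x) z = k * dot x z.
Proof. by rewrite /dot -scalemxAl mxE. Qed.

Lemma dotNl (R : realType) (x z : 'rV[R]_4) : dot (- x) z = - dot x z.
Proof. by rewrite /dot mulNmx mxE. Qed.

Lemma dotBl (R : realType) (x y z : 'rV[R]_4) : dot (x - y) z = dot x z - dot y z.
Proof. by rewrite /dot mulmxBl !mxE. Qed.

Lemma dotDr (R : realType) (x y z : 'rV[R]_4) : dot z (x + y) = dot z x + dot z y.
Proof. by rewrite dotC dotDl !(dotC z). Qed.

Lemma dotZr (R : realType) (k : R) (x z : 'rV[R]_4) : dot z (k *: x) = k * dot z x.
Proof. by rewrite dotC dotZl (dotC z). Qed.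

Lemma oframe_expand (R : realType) (b : 'M[R]_4) (x : 'rV[R]_4) : oframe b ->
  x = dot x (row 0 b) *: row 0 b + dot x (row 1 b) *: row 1 b
    + dot x (row 2 b) *: row 2 b + dot x (row 3 b) *: row 3 b.
Proof.
move=> bP; have bb : b^T *m b = 1%:M by exact: mulmx1C bP.1.
rewrite -[LHS]mulmx1 -bb mulmxA mulmx_sum_row sum4.
have E i : (x *m b^T) 0 i = dot x (row i b).
  by rewrite /dot !mxE; apply: eq_bigr => j _; rewrite !mxE.
by rewrite !E.
Qed.

(** * Adapted frames along a curve *)

Section adapted.
Variables (R : realType) (M : smoothSurface R) (f : M -> 'rV[R]_4).
Hypothesis hf : immersion f.
Implicit Types (p q : M) (b : 'M[R]_4).

Lemma adapted_oframe p b : adapted_frame f p b -> oframe b.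
Proof. by case. Qed.

Lemma tangent_expand p b w : adapted_frame f p b -> tangent_at f p w ->
  w = dot w (row 0 b) *: row 0 b + dot w (row 1 b) *: row 1 b.
Proof.
move=> bP tw; have [_ [n2 n3] _ _] := bP.
rewrite {1}(oframe_expand w (adapted_oframe bP)).
by rewrite !(dotC w (row 2 _)) !(dotC w (row 3 _)) n2 // n3 // !scale0r !addr0.
Qed.

Lemma normal_expand p b n : adapted_frame f p b -> normal_at f p n ->
  n = dot n (row 2 b) *: row 2 b + dot n (row 3 b) *: row 3 b.
Proof.
move=> bP nn; have [[t0 t1] _ _ _] := bP.
rewrite {1}(oframe_expand n (adapted_oframe bP)).
by rewrite (nn _ t0) (nn _ t1) !scale0r !add0r.
Qed.

Lemma normal_comb p (k l : R) m n :
  normal_at f p m -> normal_at f p n -> normal_at f p (k *: m + l *: n).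
Proof.
by move=> nm nn w tw; rewrite dotDl !dotZl nm // nn // !mulr0 addr0.
Qed.

(** The right-hand side satisfies the condition under [xget], and any other solution has the same
    components along rows 0 and 1. *)
Lemma tangent_projE p b x : adapted_frame f p b ->
  tangent_proj f p x = dot x (row 0 b) *: row 0 b + dot x (row 1 b) *: row 1 b.
Proof.
move=> bP; have [[t0 t1] _ o _] := bP; rewrite /tangent_proj.
set y := RHS; have ty : tangent_at f p y by exact: tangent_comb.
case: xgetP => [z _ [tz nz]|/(_ y) []]; last first.
  split=> // w /(tangent_expand bP) ->.
  rewrite dotBl /y !(dotDl, dotDr, dotZl, dotZr) !dot_row //=.
  by ring.
rewrite (tangent_expand bP tz) /y.
have := nz _ t0; have := nz _ t1; rewrite !dotBl => /subr0_eq -> /subr0_eq ->.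
reflexivity.
Qed.

Lemma velocity_skew (B : R -> 'M[R]_4) t i j : differentiable B t ->
  (\forall s \near t, oframe (B s)) ->
  dot (row j ('D_1 B t)) (row i (B t)) = - dot (row i ('D_1 B t)) (row j (B t)).
Proof.
move=> dB oB; have E : \forall s \near t, dot (row i (B s)) (row j (B s)) = (i == j)%:R.
  by apply: filterS oB => s [oB _]; rewrite dot_row.
have := derive_dot (1 : R) (differentiable_row i dB) (differentiable_row j dB).
rewrite !derive_row // (derive_near_cst _ E).
by rewrite (dotC (row i (B t))) => /esym/eqP; rewrite addrC addr_eq0 => /eqP.
Qed.

End adapted.

Section frame_along_curve.
Variables (R : realType) (M : smoothSurface R) (f : M -> 'rV[R]_4).
Hypothesis hf : immersion f.
Variables (V : set M) (b : M -> 'M[R]_4).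
Hypotheses (oV : open V) (fb : local_adapted_frame f V b).
Variables (p : M) (Vp : V p) (c : R -> M).
Hypothesis cp : curve_at p c.

Let B := b \o c.
Let B' := 'D_1 B (0 : R).

Lemma frame_curve_differentiable : differentiable B (0 : R).
Proof.
have [i ip] := chart_cover p.
exact: (curve_comp cp ip (smooth_map_differentiable fb.1 ip Vp)).1.
Qed.

Lemma frame_curve_near : \forall t \near (0 : R), adapted_frame f (c t) (B t).
Proof. by apply: filterS (curve_near cp oV Vp) => t; exact: fb.2. Qed.

Let B0 : B 0 = b p. Proof. by rewrite /B /= cp.1. Qed.

Let oB : \forall t \near (0 : R), oframe (B t).
Proof. by apply: filterS frame_curve_near => t; exact: adapted_oframe. Qed.

Definition conn i j := dot (row i B') (row j (b p)).

Lemma conn_skew i j : conn j i = - conn i j.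
Proof. by rewrite /conn -B0; apply: velocity_skew oB; exact: frame_curve_differentiable. Qed.

(** Differentiating <nu, b_k> = 0 for k = 0, 1 moves the derivative from [nu] to the frame. Only the
    value [nu p] remains, so the shape operator is tensorial in [nu]. *)
Lemma shape_opE (nu : M -> 'rV[R]_4) i : chart_dom i p ->
  differentiable (nu \o @param R M i) (@Defs.coord R M i p) ->
  (forall q, V q -> normal_at f q (nu q)) ->
  shape_op f nu p (derive1 (f \o c) 0) =
  - dot (nu p) (row 0 B') *: row 0 (b p) - dot (nu p) (row 1 B') *: row 1 (b p).
Proof.
move=> ip dnu nn; rewrite /shape_op (nablaE hf cp ip dnu).
rewrite (tangent_projE hf _ (fb.2 _ Vp)) derive1E -scaleNr.
have [dN _] := curve_comp cp ip dnu.
have dB := frame_curve_differentiable.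
have K (k : 'I_4) : (forall q, V q -> tangent_at f q (row k (b q))) ->
    dot ('D_1 (nu \o c) (0 : R)) (row k (b p)) = - dot (nu p) (row k B').
  move=> tk; have E : \forall t \near (0 : R), dot (nu (c t)) (row k (B t)) = 0.
    by apply: filterS (curve_near cp oV Vp) => t Vt; apply: nn => //; exact: tk.
  have := derive_dot (1 : R) dN (differentiable_row k dB).
  rewrite (derive_near_cst _ E) derive_row // B0 /= cp.1 => /esym/eqP.
  by rewrite addr_eq0 => /eqP.
rewrite !K //.
  by move=> q /fb.2 [[]].
by move=> q /fb.2 [[]].
Qed.

Lemma fibre_velocity (s : R -> 'M[R]_4) : differentiable s (0 : R) ->
  (\forall t \near (0 : R), asd (s t) /\ form_val (s t) (row 0 (B t)) (row 1 (B t)) = 0) ->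
  asd ('D_1 s (0 : R)) /\
  form_val ('D_1 s (0 : R)) (row 0 (b p)) (row 1 (b p)) =
    form_val (s 0) (row 0 (b p)) (row 2 (b p)) * (conn 0 3 - conn 1 2)
    - form_val (s 0) (row 0 (b p)) (row 3 (b p)) * (conn 1 3 + conn 0 2).
Proof.
move=> ds hs; have [a0 v0] := nbhs_singleton hs.
have ok := adapted_oframe (fb.2 _ Vp).
have dB := frame_curve_differentiable.
have dse i j : 'D_1 s (0 : R) i j = 'D_1 (fun t => s t i j) (0 : R).
  by rewrite derive_entry //; exact: diff_derivable.
have dsd i j : derivable (fun t => s t i j) (0 : R) 1.
  exact/diff_derivable/differentiable_entry.
(* By [asdP], anti-self-duality consists of equations between two entries with constant
   coefficients, and these survive differentiation. *)
have opp i j k l : (\forall t \near (0 : R), s t i j = - s t k l) ->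
    'D_1 s (0 : R) i j = - 'D_1 s (0 : R) k l.
  by move=> h; rewrite !dse (near_eq_derive _ h) -deriveN.
split.
  apply/asdP; split=> [i j|].
    by apply: opp; apply: filterS hs => t [/asdP [+ _] _]; exact.
  by split; apply: opp; apply: filterS hs => t [/asdP [_ []]].
have := derive_form_val (1 : R) ds (differentiable_row 0 dB) (differentiable_row 1 dB).
have E : \forall t \near (0 : R), form_val (s t) (row 0 (B t)) (row 1 (B t)) = 0.
  by apply: filterS hs => t [].
rewrite (derive_near_cst _ E).
rewrite !derive_row // B0.
have [[h1 h2 h3] _] := hodge_oframe ok.
have e1 := asd_hodge_val a0 h1; have e2 := asd_hodge_val a0 h2.
have e3 := asd_hodge_val a0 h3.
rewrite B0 in v0.
have sk i j := form_val_skew (row i (b p)) (row j (b p)) a0.1.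
have d i : form_val (s 0) (row i (b p)) (row i (b p)) = 0 by have := sk i i; lra.
(* The tangential components of the frame velocities meet only s(b_0, b_1) = 0 and diagonal values
   of s. The normal ones meet s(b_0, b_2), s(b_0, b_3), s(b_2, b_1) and s(b_3, b_1), and
   [asd_hodge_val] rewrites the last two in terms of the first two. *)
rewrite [row 0 B'](oframe_expand _ ok) [row 1 B'](oframe_expand _ ok).
have L (x y z t v : 'rV[R]_4) k0 k1 k2 k3 :
    form_val (s 0) (k0 *: x + k1 *: y + k2 *: z + k3 *: t) v =
    k0 * form_val (s 0) x v + k1 * form_val (s 0) y v
    + k2 * form_val (s 0) z v + k3 * form_val (s 0) t v.
  by rewrite /form_val !mulmxDl !dotDl -!scalemxAl !dotZl.
have L' (x y z t v : 'rV[R]_4) k0 k1 k2 k3 :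
    form_val (s 0) v (k0 *: x + k1 *: y + k2 *: z + k3 *: t) =
    k0 * form_val (s 0) v x + k1 * form_val (s 0) v y
    + k2 * form_val (s 0) v z + k3 * form_val (s 0) v t.
  by rewrite /form_val !dotDr !dotZr.
rewrite L L' -!/(conn _ _) !d v0 (sk 1 2) e2 e3.
have := conn_skew 0 0; have := conn_skew 1 1.
lra.
Qed.

End frame_along_curve.

(** * Existence of local adapted frames *)

Section gram_schmidt.
Variable R : realType.
Implicit Types x y z k : 'rV[R]_4.

Definition normalize x := (Num.sqrt (dot x x))^-1 *: x.

Definition gs2 x y := y - dot y x *: x.

Definition gs3 x y k := gs2 y (gs2 x k).

(** The triple vector product of R^4. It completes three orthonormal vectors polynomially, hence
    smoothly, and with positive orientation, since the determinant becomes its squared length. *)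
Definition cross x y z : 'rV[R]_4 := \row_j det4 x y z (std_e R j).

Definition rows4 (x y z t : 'rV[R]_4) : 'M[R]_4 :=
  \matrix_(i < 4, j < 4) (nth 0 [:: x; y; z; t] i) 0 j.

Lemma row_rows4 x y z (t : 'rV[R]_4) : let b := rows4 x y z t in
  [/\ row 0 b = x, row 1 b = y, row 2 b = z & row 3 b = t].
Proof. by split; apply/rowP => j; rewrite !mxE. Qed.

Lemma dot_gt0 x : x != 0 -> 0 < dot x x.
Proof.
move=> x0; rewrite dotE lt0r.
have sq i : 0 <= x 0 i * x 0 i by rewrite -expr2 sqr_ge0.
have := sq 0; have := sq 1; have := sq 2; have := sq 3 => s3 s2 s1 s0.
apply/andP; split; last by rewrite !addr_ge0.
apply: contraNneq x0 => S; apply/eqP/rowP.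
have e i : x 0 i * x 0 i = 0 -> x 0 i = (0 : 'rV[R]_4) 0 i.
  by move/eqP; rewrite mxE -expr2 sqrf_eq0 => /eqP.
by apply: forall4; apply: e; lra.
Qed.

Lemma dot_normalize x : 0 < dot x x -> dot (normalize x) (normalize x) = 1.
Proof.
move=> x0; rewrite dotZl dotZr -{3}(sqr_sqrtr (ltW x0)).
by field; rewrite gt_eqF // sqrtr_gt0.
Qed.

Lemma normalizeK x : 0 < dot x x -> x = Num.sqrt (dot x x) *: normalize x.
Proof. by move=> x0; rewrite scalerA mulfV ?scale1r // gt_eqF // sqrtr_gt0. Qed.

Lemma dot_gs2 x y : dot x x = 1 -> dot (gs2 x y) x = 0.
Proof. by move=> x1; rewrite dotBl dotZl x1; ring. Qed.

Lemma dot_gs3 x y k : dot x x = 1 -> dot y y = 1 -> dot y x = 0 ->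
  dot (gs3 x y k) x = 0 /\ dot (gs3 x y k) y = 0.
Proof.
move=> x1 y1 yx; split; last exact: dot_gs2.
by rewrite dotBl dotZl dot_gs2 // yx; ring.
Qed.

Lemma dot_cross x y z (t : 'rV[R]_4) : dot (cross x y z) t = det4 x y z t.
Proof. by rewrite dotE /det4 !mxE /= /det4 !std_eE /=; ring. Qed.

Lemma dot_cross_cross x y z :
  dot (cross x y z) (cross x y z) =
  dot x x * (dot y y * dot z z - dot y z * dot y z)
  - dot x y * (dot x y * dot z z - dot y z * dot x z)
  + dot x z * (dot x y * dot y z - dot y y * dot x z).
Proof. by rewrite !dotE !mxE /det4 !std_eE /=; ring. Qed.

Lemma rows4_oframe x y z : dot x x = 1 -> dot y y = 1 -> dot z z = 1 ->
  dot x y = 0 -> dot x z = 0 -> dot y z = 0 ->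
  oframe (rows4 x y z (cross x y z)).
Proof.
move=> xx yy zz xy xz yz; set t := cross x y z.
have tt : dot t t = 1 by rewrite dot_cross_cross xx yy zz xy xz yz; ring.
have tx : dot t x = 0 by rewrite dot_cross /det4; ring.
have ty : dot t y = 0 by rewrite dot_cross /det4; ring.
have tz : dot t z = 0 by rewrite dot_cross /det4; ring.
have [e0 e1 e2 e3] := row_rows4 x y z t.
split; last by rewrite det_row4 e0 e1 e2 e3 -dot_cross tt ltr01.
have E i j : (rows4 x y z t *m (rows4 x y z t)^T) i j
    = dot (row i (rows4 x y z t)) (row j (rows4 x y z t)).
  by rewrite /dot !mxE; apply: eq_bigr => l _; rewrite !mxE.
apply/matrixP; do 2!apply: forall4; rewrite E mxE ?e0 ?e1 ?e2 ?e3 //=;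
  by rewrite ?tx // ?ty // ?tz // dotC ?xy ?xz ?yz ?tx ?ty ?tz.
Qed.

(** The squared lengths of the normal parts of the four standard vectors add up to 4 - 1 - 1 = 2, so
    one of them is positive. *)
Lemma gs3_neq0 x y : dot x x = 1 -> dot y y = 1 -> dot y x = 0 ->
  exists k, 0 < dot (gs3 x y k) (gs3 x y k).
Proof.
move=> x1 y1 yx.
have E i : dot (gs3 x y (std_e R i)) (gs3 x y (std_e R i)) = 1 - x 0 i ^+ 2 - y 0 i ^+ 2.
  have s1 : dot (std_e R i) (std_e R i) = 1 by rewrite dot_row ?trmx1 ?mulmx1 // eqxx.
  have s2 (v : 'rV[R]_4) : dot (std_e R i) v = v 0 i.
    by move: i {s1}; apply: forall4; rewrite dotE !std_eE /=; ring.
  rewrite /gs3 /gs2 !(dotBl, dotZl, dotC _ (_ - _), dotC _ (_ *: _)).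
  rewrite x1 y1 (dotC x y) yx.
  by rewrite !(dotC x (std_e R i), dotC y (std_e R i)) !s1 !s2; ring.
have [//|N] := pselect (exists k, 0 < dot (gs3 x y k) (gs3 x y k)).
have le0 i : 1 - x 0 i ^+ 2 - y 0 i ^+ 2 <= 0.
  by rewrite -E leNgt; apply/negP => h; apply: N; exists (std_e R i).
have := le0 0; have := le0 1; have := le0 2; have := le0 3.
by move: x1 y1; rewrite !dotE; lra.
Qed.

End gram_schmidt.

Section Ck_gram_schmidt.
Variables (R : realType) (V : normedModType R) (k : nat) (U : set V).
Hypothesis oU : open U.
Implicit Types X Y Z : V -> 'rV[R]_4.

Lemma Ck_dot X Y : Ck k U X -> Ck k U Y -> Ck k U (fun u => dot (X u) (Y u)).
Proof.
move=> cX cY; apply: (Ck_eq oU (f := fun u => \sum_(j < 4) X u 0 j * Y u 0 j)).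
  by move=> u _; rewrite /dot mxE; apply: eq_bigr => j _; rewrite mxE.
by apply: Ck_sum => // j; apply: CkM => //; exact: Ck_entry.
Qed.

Lemma CkZ (a : V -> R) X : Ck k U a -> Ck k U X -> Ck k U (fun u => a u *: X u).
Proof.
move=> ca cX; apply: Ck_mx => // i j; apply: (Ck_eq oU (f := fun u => a u * X u i j)).
  by move=> u _; rewrite mxE.
by apply: CkM => //; exact: Ck_entry.
Qed.

Lemma Ck_gs2 X Y : Ck k U X -> Ck k U Y -> Ck k U (fun u => gs2 (X u) (Y u)).
Proof.
move=> cX cY; apply: (Ck_eq oU (f := fun u => Y u + (- dot (Y u) (X u)) *: X u)).
  by move=> u _; rewrite scaleNr.
by apply: CkD => //; apply: CkZ => //; apply: CkN => //; exact: Ck_dot.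
Qed.

Lemma Ck_normalize X : (forall u, U u -> 0 < dot (X u) (X u)) ->
  Ck k U X -> Ck k U (fun u => normalize (X u)).
Proof.
by move=> X0 cX; apply: CkZ => //; apply: Ck_invsqrt => //; exact: Ck_dot.
Qed.

Lemma Ck_cross X Y Z : Ck k U X -> Ck k U Y -> Ck k U Z ->
  Ck k U (fun u => cross (X u) (Y u) (Z u)).
Proof.
move=> cX cY cZ; apply: Ck_mx => // i j.
apply: (Ck_eq oU (f := fun u => det4 (X u) (Y u) (Z u) (std_e R j))).
  by move=> u _; rewrite mxE.
have cs (l : 'I_4) : Ck k U (fun=> std_e R j 0 l) := Ck_cst k U _.
have cx (l : 'I_4) : Ck k U (fun u => X u 0 l) by exact: Ck_entry.
have cy (l : 'I_4) : Ck k U (fun u => Y u 0 l) by exact: Ck_entry.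
have cz (l : 'I_4) : Ck k U (fun u => Z u 0 l) by exact: Ck_entry.
rewrite /det4; do ?[exact: cs|exact: cx|exact: cy|exact: cz
  |apply: CkB => //|apply: CkM => //|apply: CkD => //].
Qed.

Lemma Ck_rows4 X Y Z (T : V -> 'rV[R]_4) :
  Ck k U X -> Ck k U Y -> Ck k U Z -> Ck k U T ->
  Ck k U (fun u => rows4 (X u) (Y u) (Z u) (T u)).
Proof.
move=> cX cY cZ cT; apply: Ck_mx => // i j.
have E (W : V -> 'rV[R]_4) : (forall u, nth 0 [:: X u; Y u; Z u; T u] i = W u) ->
    Ck k U W -> Ck k U (fun u => rows4 (X u) (Y u) (Z u) (T u) i j).
  move=> h cW; apply: (Ck_eq oU (f := fun u => W u 0 j)); last exact: Ck_entry.
  by move=> u _; rewrite mxE h.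
by move: i E; apply: forall4 => E; apply: E => //.
Qed.

End Ck_gram_schmidt.

(** * A smooth adapted frame on a chart *)

Section local_frame.
Variables (R : realType) (M : smoothSurface R) (f : M -> 'rV[R]_4).
Hypothesis hf : immersion f.

Local Notation crd i := (@Defs.coord R M i).
Local Notation prm i := (@param R M i).
Local Notation chart_img i := (crd i @` chart_dom i).

Variable i : chart_index M.
Let g := f \o prm i.
Let X (j : 'I_2) u := 'D_('e_j) g u.
Let e0 u := normalize (X 0 u).
Let e1 u := normalize (gs2 (e0 u) (X 1 u)).

Let oU : open (chart_img i). Proof. exact: coord_open. Qed.

Let sg : smooth_on (chart_img i) g.
Proof. by move=> k; apply: Ck_sub (hf.1 i k) => _ [q iq <-]; exists q. Qed.

Let dg u : chart_img i u -> differentiable g u.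
Proof. exact: (sg 1).1. Qed.

Let XE j u : chart_img i u -> X j u = 'd g u 'e_j.
Proof. by move=> /dg; exact: deriveE. Qed.

Let comb_neq0 (a b : R) u : chart_img i u -> (a != 0) || (b != 0) ->
  a *: X 0 u + b *: X 1 u != 0.
Proof.
move=> Uu ab; have [iu uK] := paramK Uu.
have inj : injective ('d g u) by rewrite -uK; exact: (hf.2 i _ iu).
have E : a *: X 0 u + b *: X 1 u = 'd g u (a *: 'e_0 + b *: 'e_1).
  by rewrite linearD !linearZ /= !XE.
rewrite E; apply: contraL ab => /eqP h.
have {}h : 'd g u (a *: 'e_0 + b *: 'e_1) = 'd g u 0 by rewrite h linear0.
move: (inj _ _ h) => /rowP h'.
by move: (h' 0) (h' 1); rewrite !mxE /= !mulr1 !mulr0 addr0 add0r => -> ->; rewrite eqxx.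
Qed.

Let X0 u : chart_img i u -> 0 < dot (X 0 u) (X 0 u).
Proof.
move=> Uu; apply: dot_gt0; have := comb_neq0 (a := 1) (b := 0) Uu.
by rewrite scale1r scale0r addr0 oner_neq0; exact.
Qed.

Let Y0 u : chart_img i u -> 0 < dot (gs2 (e0 u) (X 1 u)) (gs2 (e0 u) (X 1 u)).
Proof.
move=> Uu; apply: dot_gt0.
(* With this [a] the vector [gs2 (e0 u) (X 1 u)] equals [X 1 u + a *: X 0 u], which is nonzero by
   independence of the coordinate derivatives. *)
set a := - dot (X 1 u) (e0 u) * (Num.sqrt (dot (X 0 u) (X 0 u)))^-1.
have := comb_neq0 (a := a) (b := 1) Uu; rewrite oner_neq0 orbT => /(_ isT).
by rewrite /gs2 {2}/e0 /normalize scalerA -scaleNr -mulNr -/a scale1r addrC.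
Qed.

Let ee0 u : chart_img i u -> dot (e0 u) (e0 u) = 1.
Proof. by move=> /X0; exact: dot_normalize. Qed.

Let ee1 u : chart_img i u -> dot (e1 u) (e1 u) = 1.
Proof. by move=> /Y0; exact: dot_normalize. Qed.

Let e01 u : chart_img i u -> dot (e1 u) (e0 u) = 0.
Proof. by move=> Uu; rewrite dotZl dot_gs2 ?mulr0 // ee0. Qed.

Let cX k j : Ck k (chart_img i) (X j).
Proof. exact: (sg k.+1).2. Qed.

Let ce0 k : Ck k (chart_img i) e0.
Proof. by apply: (Ck_normalize oU X0); exact: cX. Qed.

Let ce1 k : Ck k (chart_img i) e1.
Proof. by apply: (Ck_normalize oU Y0); exact: Ck_gs2. Qed.

Let tangent_e u : chart_img i u ->
  tangent_at f (prm i u) (e0 u) /\ tangent_at f (prm i u) (e1 u).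
Proof.
move=> Uu; have [iu uK] := paramK Uu.
have tX j : tangent_at f (prm i u) (X j u).
  by apply/(tangent_chart hf _ iu); exists 'e_j; rewrite uK; exact: XE.
have t0 : tangent_at f (prm i u) (e0 u).
  have := tangent_comb hf (Num.sqrt (dot (X 0 u) (X 0 u)))^-1 0 (tX 0) (tX 0).
  by rewrite scale0r addr0.
split=> //.
have := tangent_comb hf 1 (- dot (X 1 u) (e0 u)) (tX 1) t0.
rewrite scale1r scaleNr => t2.
have := tangent_comb hf (Num.sqrt (dot (gs2 (e0 u) (X 1 u)) (gs2 (e0 u) (X 1 u))))^-1 0 t2 t2.
by rewrite scale0r addr0.
Qed.

(** Gram-Schmidt is invertible: [X 0 u] and [X 1 u], which span the tangent plane, are combinations
    of [e0 u] and [e1 u]. *)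
Let normal_e u n : chart_img i u -> dot n (e0 u) = 0 -> dot n (e1 u) = 0 ->
  normal_at f (prm i u) n.
Proof.
move=> Uu n0 n1 w; have [iu uK] := paramK Uu.
have nX0 : dot n (X 0 u) = 0.
  by rewrite (normalizeK (X0 Uu)) dotZr -/(e0 u) n0 mulr0.
have nX1 : dot n (X 1 u) = 0.
  have -> : X 1 u = gs2 (e0 u) (X 1 u) + dot (X 1 u) (e0 u) *: e0 u by rewrite /gs2 subrK.
  rewrite dotDr dotZr n0 mulr0 addr0.
  by rewrite (normalizeK (Y0 Uu)) dotZr -/(e1 u) n1 mulr0.
move=> /(tangent_chart hf _ iu) [v ->]; rewrite uK.
rewrite (row_sum_delta v) linear_sum /= !big_ord_recl big_ord0 addr0.
rewrite dotDr !linearZ /= !dotZr -!/g.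
have -> : lift ord0 ord0 = 1 :> 'I_2 by exact/val_inj.
by rewrite -!XE // nX0 nX1 !mulr0 addr0.
Qed.

Lemma local_frame_chart p : chart_dom i p ->
  exists (V : set M) (b : M -> 'M[R]_4), [/\ open V, V p & local_adapted_frame f V b].
Proof.
move=> ip; have Up : chart_img i (crd i p) by exists p.
(* The constant vector [k] is chosen at [p] only. Its normal part stays nonzero on the open set [W],
   and the fourth vector is then the cross product. *)
have [k kp] := gs3_neq0 (ee0 Up) (ee1 Up) (e01 Up).
pose r u := gs3 (e0 u) (e1 u) k.
pose n u := normalize (r u).
pose W := chart_img i `&` (fun u => dot (r u) (r u)) @^-1` [set x : R | 0 < x].
have cr l : Ck l (chart_img i) r.
  by apply: Ck_gs2 => //; apply: Ck_gs2 => //; exact: Ck_cst.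
have oW : open W.
  apply: (open_preimage_in oU (@open_gt _ _)).
  exact: (Ck_continuous (Ck_dot oU (cr 0%N) (cr 0%N))).
have WU : W `<=` chart_img i by move=> u [].
pose Bm u := rows4 (e0 u) (e1 u) (n u) (cross (e0 u) (e1 u) (n u)).
have cB l : Ck l W Bm.
  have c0 := Ck_sub WU (ce0 l); have c1 := Ck_sub WU (ce1 l).
  have cn : Ck l W n.
    by apply: (Ck_normalize oW) (Ck_sub WU (cr l)) => u [].
  by apply: Ck_rows4 => //; exact: Ck_cross.
have oV : open (chart_dom i `&` crd i @^-1` W).
  exact: (open_preimage_in (@chart_dom_open R M i) oW (@Defs.coord_continuous R M i)).
exists (chart_dom i `&` crd i @^-1` W), (Bm \o crd i).
split; [exact: oV|exact: (conj ip (conj Up kp))|split].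
    (* The frame is built in chart [i]; seen from chart [j] it is [Bm] after a transition map. *)
    move=> j l; rewrite -[_ \o prm j]/(Bm \o (crd i \o prm j)).
    have oVj := chart_image_open (i := j) oV.
    apply: (Ck_comp_mx oVj oW _ _ (cB l)).
      by move=> _ [q [jq [iq Wq]] <-] /=; rewrite coordK.
    apply: Ck_sub (@transition_smooth R M j i l).
    by move=> _ [q [jq [iq Wq]] <-]; exists q.
move=> q [iq [Uq rq]] /=; set u := crd i q.
  have uK : prm i u = q by exact: coordK.
  have nn : dot (n u) (n u) = 1 by exact: dot_normalize.
  have [r0 r1] := dot_gs3 k (ee0 Uq) (ee1 Uq) (e01 Uq).
  have n0 : dot (n u) (e0 u) = 0 by rewrite dotZl r0 mulr0.
  have n1 : dot (n u) (e1 u) = 0 by rewrite dotZl r1 mulr0.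
  have n0' : dot (e0 u) (n u) = 0 by rewrite dotC.
  have n1' : dot (e1 u) (n u) = 0 by rewrite dotC.
  have e01' : dot (e0 u) (e1 u) = 0 by rewrite dotC e01.
  have [orth det_gt0] := rows4_oframe (ee0 Uq) (ee1 Uq) nn e01' n0' n1'.
  have [E0 E1 E2 E3] := row_rows4 (e0 u) (e1 u) (n u) (cross (e0 u) (e1 u) (n u)).
  rewrite -uK /Bm; split; [| |exact: orth|exact: det_gt0].
    by rewrite E0 E1; exact: tangent_e.
  rewrite E2 E3; split; first exact: normal_e.
  by apply: normal_e => //; rewrite dot_cross /det4; ring.
Qed.

End local_frame.

Lemma local_frame_exists (R : realType) (M : smoothSurface R) (f : M -> 'rV[R]_4) p :
  immersion f ->
  exists (V : set M) (b : M -> 'M[R]_4), [/\ open V, V p & local_adapted_frame f V b].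
Proof. by move=> hf; have [i] := chart_cover p; exact: local_frame_chart. Qed.

Lemma wedge_row_entry (R : realType) (b : 'M[R]_4) k l i j :
  wedge (row k b) (row l b) i j = b k i * b l j - b l i * b k j.
Proof. by rewrite wedgeE !mxE. Qed.

Lemma Ck_wedge_rows (R : realType) (V : normedModType R) n (U : set V)
    (F : V -> 'M[R]_4) k l k' l' : open U -> Ck n U F ->
  Ck n U (fun u => wedge (row k (F u)) (row l (F u)) - wedge (row k' (F u)) (row l' (F u))).
Proof.
move=> oU cF; apply: Ck_mx => // i j.
have D (A B : 'M[R]_4) : (A - B) i j = A i j - B i j by rewrite !mxE.
have cf r s : Ck n U (fun u => F u r s) by exact: Ck_entry.
apply: (Ck_eq oU (f := fun u => (F u k i * F u l j - F u l i * F u k j)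
    - (F u k' i * F u l' j - F u l' i * F u k' j))).
  by move=> u _; rewrite D !wedge_row_entry.
by apply: CkB => //; apply: CkB => //; apply: CkM.
Qed.

(** * Coassociativity and the second fundamental form *)

Section main.
Variables (R : realType) (M : smoothSurface R) (f : M -> 'rV[R]_4).
Hypothesis hf : immersion f.
Implicit Types (p : M) (V : set M) (b : M -> 'M[R]_4) (c : R -> M).

(** The fibre is defined by orthogonality to [omega1] of every adapted frame at [p]. All these
    frames span the same tangent plane, so vanishing on one of them is enough. *)
Lemma bundleF_frame p (b : 'M[R]_4) eta : adapted_frame f p b ->
  bundleF f p eta <-> asd eta /\ form_val eta (row 0 b) (row 1 b) = 0.
Proof.
move=> bP; split=> -[a h]; split=> //.
  have [<- _ _] := form_dot_omega (adapted_oframe bP) a.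
  by apply: h; exists b, 1; rewrite scale1r.
move=> _ [b' [k [bP' ->]]]; rewrite /form_dot linearZ /= -scalemxAr linearZ /= mulrCA.
have [E _ _] := form_dot_omega (adapted_oframe bP') a.
have [[t0 t1] _ _ _] := bP'.
rewrite -/(form_dot eta (omega1 b')) E.
by rewrite (form_val_tangent a.1 h (tangent_expand bP t0) (tangent_expand bP t1)) mulr0.
Qed.

(** The fibre is a linear space, so the line [eta + t *: xi] over the constant curve stays in it. *)
Lemma vertical_tangent p eta xi : bundleF f p eta -> bundleF f p xi ->
  tangent_total f p eta (0, xi).
Proof.
move=> Fe Fx; exists [set: R], (fun=> p), (fun t => eta + t *: xi).
split.
- split=> //; [exact: openT| |by move=> k; apply: Ck_line; exact: openT].
  split=> [t _|i k]; first exact: cst_continuous.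
  exact: (Ck_cst k _ (@Defs.coord R M i p)).
- by rewrite scale0r addr0.
- move=> t _; have [V [b [_ Vp fb]]] := local_frame_exists p hf.
  have bP := fb.2 _ Vp.
  move/(bundleF_frame _ bP): Fe => [a v]; move/(bundleF_frame _ bP): Fx => [a' v'].
  apply/(bundleF_frame _ bP); split.
    apply/asdP; have [s1 [p1 q1 r1]] := (asdP eta).1 a.
    have [s2 [p2 q2 r2]] := (asdP xi).1 a'.
    split=> [j k|]; first by rewrite !mxE (s1 j k) (s2 j k); ring.
    by split; rewrite !mxE ?p1 ?p2 ?q1 ?q2 ?r1 ?r2; ring.
  have -> : form_val (eta + t *: xi) (row 0 (b p)) (row 1 (b p)) =
      form_val eta (row 0 (b p)) (row 1 (b p)) + t * form_val xi (row 0 (b p)) (row 1 (b p)).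
    by rewrite /form_val mulmxDr dotDl -scalemxAr dotZl.
  by rewrite v v' mulr0 addr0.
- by rewrite !derive1E derive_line (_ : f \o (fun=> p) = cst (f p)) // derive_cst.
Qed.

(** The second formula is the first with (a, a') replaced by (- a', a), the normal coordinates of J
    nu. *)
Lemma shape_op_conn V b p c (nu : M -> 'rV[R]_4) i : open V ->
  local_adapted_frame f V b -> V p -> curve_at p c -> chart_dom i p ->
  differentiable (nu \o @param R M i) (@Defs.coord R M i p) ->
  (forall q, V q -> normal_at f q (nu q)) ->
  let w := derive1 (f \o c) 0 in
  let a := dot (nu p) (row 2 (b p)) in
  let a' := dot (nu p) (row 3 (b p)) in
  let A := conn b p c in
  shape_op f nu p w =
    - (a * A 0 2 + a' * A 0 3) *: row 0 (b p) - (a * A 1 2 + a' * A 1 3) *: row 1 (b p)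
  /\ shape_op f (fun q => JN (b q) (nu q)) p w =
    - (a * A 0 3 - a' * A 0 2) *: row 0 (b p) - (a * A 1 3 - a' * A 1 2) *: row 1 (b p).
Proof.
move=> oV fb Vp cp ip dnu nn w a a' A; have bP := fb.2 _ Vp.
have E := normal_expand bP (nn _ Vp).
have dot2 k l (B : 'M[R]_4) m : dot (k *: row 2 (b p) + l *: row 3 (b p)) (row m B)
    = k * dot (row m B) (row 2 (b p)) + l * dot (row m B) (row 3 (b p)).
  by rewrite dotDl !dotZl !(dotC _ (row m B)).
split.
  rewrite (shape_opE hf oV fb Vp cp ip dnu nn) E !dot2 -/(conn _ _ _ _ _).
  by rewrite -!/(A _ _) -/a -/a'.
have db := smooth_map_differentiable fb.1 ip Vp.
have dJ : differentiable ((fun q => JN (b q) (nu q)) \o @param R M i) (@Defs.coord R M i p).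
  have dr k := differentiable_row k db.
  by apply: differentiableB; apply: differentiable_scale => //; exact: differentiable_dot.
have nJ q : V q -> normal_at f q (JN (b q) (nu q)).
  move=> Vq; have [_ [n2 n3] _ _] := fb.2 _ Vq.
  by rewrite /JN /rotJ -scaleNr; exact: normal_comb.
have JE : JN (b p) (nu p) = - a' *: row 2 (b p) + a *: row 3 (b p).
  by rewrite addrC scaleNr.
rewrite (shape_opE hf oV fb Vp cp ip dJ nJ) JE !dot2 !mulNr.
by rewrite ![- _ + _]addrC.
Qed.

Lemma JT_comb (b : 'M[R]_4) (k l : R) : oframe b ->
  JT b (k *: row 0 b - l *: row 1 b) = k *: row 1 b + l *: row 0 b.
Proof.
move=> bP; rewrite /JT /rotJ !dotBl !dotZl !(dot_row _ _ bP.1) /=.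
by rewrite !mulr1 !mulr0 subr0 sub0r scaleNr opprK.
Qed.

Lemma second_form_conn V b p c : second_form_condition f -> open V ->
  local_adapted_frame f V b -> V p -> curve_at p c ->
  conn b p c 0 3 = conn b p c 1 2 /\ conn b p c 1 3 = - conn b p c 0 2.
Proof.
move=> H oV fb Vp cp; have bP := fb.2 _ Vp; have ok := adapted_oframe bP.
have [i ip] := chart_cover p.
(* This single field gives both equations: its condition has two tangential components, one for
   each. *)
pose nu q := row 2 (b q).
have nn q : V q -> normal_at f q (nu q) by move=> /fb.2 [_ []].
have dnu : differentiable (nu \o @param R M i) (@Defs.coord R M i p).
  exact/differentiable_row/(smooth_map_differentiable fb.1 ip Vp).
have snu : smooth_map V nu.
  move=> j k; apply: Ck_mx; first exact: chart_image_open.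
  move=> r s; apply: (Ck_eq _ (f := fun u => b (param j u) 2 s)).
  - exact: chart_image_open.
  - by move=> u _; rewrite mxE.
  - by apply: Ck_entry; [exact: chart_image_open|exact: fb.1].
have tw : tangent_at f p (derive1 (f \o c) 0) by exists c.
have := H V b nu oV fb (conj snu nn) p _ Vp tw.
have [-> ->] := shape_op_conn oV fb Vp cp ip dnu nn.
rewrite JT_comb // /nu !(dot_row _ _ ok.1) /= => E.
have := congr1 (fun x : 'rV[R]_4 => dot x (row 0 (b p))) E.
have := congr1 (fun x : 'rV[R]_4 => dot x (row 1 (b p))) E.
rewrite !(dotDl, dotBl, dotNl, dotZl) !(dot_row _ _ ok.1) /=.
by split; lra.
Qed.

Lemma coassociative_conn V b p i v : total_space_coassociative f -> open V ->
  local_adapted_frame f V b -> V p -> chart_dom i p ->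
  let c := chart_line i p v in
  conn b p c 0 3 = conn b p c 1 2 /\ conn b p c 1 3 = - conn b p c 0 2.
Proof.
move=> H oV fb Vp ip c; have bP := fb.2 _ Vp; have ok := adapted_oframe bP.
have cp : curve_at p c by exact: chart_line_at.
have [a1 a2 a3] := asd_omega ok.
have [_ [[v1 v2 v3] [w1 w2 w3]]] := form_val_omega ok.
have F2 : bundleF f p (omega2 (b p)) by apply/(bundleF_frame _ bP).
have F3 : bundleF f p (omega3 (b p)) by apply/(bundleF_frame _ bP).
pose T (t : R) := @Defs.coord R M i p + t *: v.
pose W := @Defs.coord R M i @` (chart_dom i `&` V).
have oW : open W by exact: chart_image_open.
(* Times are restricted to those at which the line stays in [V], where the frame exists and the test
   sections are smooth. *)
pose I : set R := [set: R] `&` T @^-1` W.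
have oI : open I.
  apply: (open_preimage_in openT oW); exact: (Ck_continuous (Ck_line 0 _ v openT)).
have I0 : I 0 by split => //; rewrite /T /= scale0r addr0; exists p.
have IV t : I t -> chart_dom i (c t) /\ V (c t).
  by move=> [_ [q [iq Vq] qT]]; rewrite /c /chart_line -/(T t) -qT coordK.
have sc : smooth_curve I c.
  have [cc sc] := smooth_chart_line i p v.
  have sub : I `<=` [set t | (@Defs.coord R M i @` chart_dom i) (@Defs.coord R M i p + t *: v)].
    by move=> t [_ [q [iq Vq] qT]]; exists q.
  split=> [t /sub|j k]; first exact: cc.
  by apply: Ck_sub (sc j k) => t [/sub].
have sb : smooth_on I (b \o c).
  move=> k; have cT : Ck k I T by exact: Ck_line.
  by apply: (Ck_comp_mx oI oW _ cT (fb.1 i k)) => t [].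
(* [phi] is evaluated on the vertical vectors of [omega2] and [omega3] and the velocity of [s]. Each
   evaluation term contains a zero horizontal part, so only the determinant survives. *)
have key (s : R -> 'M[R]_4) : smooth_on I s -> bundleF f p (s 0) ->
    (forall t, I t -> asd (s t) /\ form_val (s t) (row 0 (b (c t))) (row 1 (b (c t))) = 0) ->
    form_val ('D_1 s (0 : R)) (row 0 (b p)) (row 1 (b p)) = 0.
  move=> ss F0 Fs; have ds : differentiable s (0 : R) by exact: (ss 1%N).1.
  have [ad _] := fibre_velocity oV fb Vp cp ds (open_near oI I0 Fs).
  apply: (asd_det_vertical ok ad).
  have t3 : tangent_total f p (s 0) (derive1 (f \o c) 0, derive1 s 0).
    exists I, c, s; split; [split; [exact: oI|exact: I0|exact: sc|exact: ss]| | |reflexivity].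
      by split; [exact: cp.1|].
    move=> t It; apply/(bundleF_frame _ (fb.2 _ (IV _ It).2)); exact: Fs.
  rewrite (derive1E s) in t3.
  have := H p (s 0) F0 _ _ _ (vertical_tangent F0 F2) (vertical_tangent F0 F3) t3.
  rewrite phi_asd //.
  have f0l (x : 'M[R]_4) y : form_val x 0 y = 0 by rewrite /form_val /dot !mul0mx mxE.
  have f0r (x : 'M[R]_4) y : form_val x y 0 = 0 by rewrite /form_val /dot trmx0 mulmx0 mxE.
  by rewrite !f0l !f0r !addr0.
have sw k l k' l' : smooth_on I (fun t => wedge (row k (b (c t))) (row l (b (c t)))
    - wedge (row k' (b (c t))) (row l' (b (c t)))).
  by move=> n; apply: (Ck_wedge_rows (F := b \o c)) => //; exact: sb.
have c0 : c 0 = p := cp.1.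
have fI t : I t -> oframe (b (c t)) by move=> /IV[_] /fb.2; exact: adapted_oframe.
split.
  (* Here (x, y) = (1, 0), and [fibre_velocity] reduces to A_03 = A_12. *)
  pose s t := omega2 (b (c t)).
  have Fs t : I t -> asd (s t) /\ form_val (s t) (row 0 (b (c t))) (row 1 (b (c t))) = 0.
    move=> /fI o; have [_ ? _] := asd_omega o.
    by have [_ [[? _ _] _]] := form_val_omega o.
  have ss : smooth_on I s by exact: sw.
  have s0 : s 0 = omega2 (b p) by rewrite /s c0.
  have := key s ss; rewrite s0 => /(_ F2 Fs) K.
  have [_] := fibre_velocity oV fb Vp cp ((ss 1%N).1 0 I0) (open_near oI I0 Fs).
  by rewrite K s0 v2 v3; lra.
(* Here (x, y) = (0, 1), and the equation is A_13 = - A_02. *)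
pose s t := omega3 (b (c t)).
have Fs t : I t -> asd (s t) /\ form_val (s t) (row 0 (b (c t))) (row 1 (b (c t))) = 0.
  move=> /fI o; have [_ _ ?] := asd_omega o.
  by have [_ [_ [? _ _]]] := form_val_omega o.
have ss : smooth_on I s by exact: sw.
have s0 : s 0 = omega3 (b p) by rewrite /s c0.
have := key s ss; rewrite s0 => /(_ F3 Fs) K.
have [_] := fibre_velocity oV fb Vp cp ((ss 1%N).1 0 I0) (open_near oI I0 Fs).
by rewrite K s0 w2 w3; lra.
Qed.

End main.

Theorem theorem4p2p1 (R : realType) (M : smoothSurface R) (f : M -> 'rV[R]_4)
    (hf : immersion f) :
  total_space_coassociative f <-> second_form_condition f.
Proof.
split=> [H V b nu oV fb [snu nn] p w Vp tw|H p eta Fp u v w tu tv tw].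
  have [i ip] := chart_cover p.
  have [v wE] := (tangent_chart hf w ip).1 tw.
  (* The vector [w] is realised by a coordinate line, the curve for which [coassociative_conn]
     supplies the equations. *)
  have cp := chart_line_at v ip.
  have wc : w = derive1 (f \o chart_line i p v) 0.
    by have [_ ->] := curve_comp cp ip (immersion_differentiable hf ip); rewrite chart_line_velocity.
  have [h1 h2] := coassociative_conn hf v H oV fb Vp ip.
  have dnu := smooth_map_differentiable snu ip Vp.
  rewrite wc; have [-> ->] := shape_op_conn hf oV fb Vp cp ip dnu nn.
  rewrite JT_comb; last exact: adapted_oframe (fb.2 _ Vp).
  by rewrite h1 h2; apply/rowP => j; rewrite !mxE; ring.
have [V [b [oV Vp fb]]] := local_frame_exists p hf.
have bP := fb.2 _ Vp.
apply: (phi_horizontal_eq0 (adapted_oframe bP)) => t ht.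
(* The three vectors may come from different curves; each meets the conditions of
   [phi_horizontal_eq0] through its own curve, with the common frame [b p]. *)
have {ht} : tangent_total f p eta t by case: ht => [->|[->|->]].
move=> [I [c [s [[oI I0 sc ss] [c0 s0] Fs ->]]]] /=.
have cp : curve_at p c by split=> //; exists I.
have nF : \forall x \near (0 : R), asd (s x) /\
    form_val (s x) (row 0 ((b \o c) x)) (row 1 ((b \o c) x)) = 0.
  apply: filterS2 (open_near oI I0 Fs) (frame_curve_near oV fb Vp cp) => x Fx bx.
  exact/(bundleF_frame _ bx).
have [ad E] := fibre_velocity oV fb Vp cp ((ss 1%N).1 0 I0) nF.
have [h1 h2] := second_form_conn hf H oV fb Vp cp.
rewrite derive1E; split=> //.
  by rewrite E h1 h2 subrr addNr !mulr0 subrr.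
exists (dot (derive1 (f \o c) 0) (row 0 (b p))), (dot (derive1 (f \o c) 0) (row 1 (b p))).
by apply: (tangent_expand bP); exists c.
Qed.
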